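(* Let $a>b>0$, let $\mathcal{E}:\ \frac{\mathsf{x}^2}{a}+\frac{\mathsf{y}^2}{b}=1$, and let $\mathcal{C}_{\lambda_0}$, $\lambda_0\in(0,b)\cup(b,a)$, be a conic confocal with $\mathcal{E}$. Let $n$ be a positive integer. The billiard trajectories within $\mathcal{E}$ with caustic $\mathcal{C}_{\lambda_0}$ are $n$-periodic if and only if $nQ_0\sim nQ_{\lambda_0}$ on the elliptic curve $$\mathscr{C}:\ y^2=(a-x)(b-x)(\lambda_0-x),$$ where $Q_0$ is a point of $\mathscr{C}$ corresponding to $x=0$ and $Q_{\lambda_0}$ is the point corresponding to $x=\lambda_0$.
   Context: The confocal family is $\mathcal{C}_{\lambda}:\ \frac{\mathsf{x}^2}{a-\lambda}+\frac{\mathsf{y}^2}{b-\lambda}=1$; $\mathcal{C}_\lambda$ is an ellipse for $\lambda<b$ and a hyperbola for $\lambda\in(b,a)$. A billiard trajectory within $\mathcal{E}$ is a polygonal line with vertices on $\mathcal{E}$ obeying the reflection law (angle of incidence equals angle of reflection) at each vertex; it has caustic $\mathcal{C}_{\lambda_0}$ if all lines containing its segments are tangent to $\mathcal{C}_{\lambda_0}$. A trajectory is $n$-periodic if it closes after $n$ reflections ($n$ is not required to be minimal); by Poncelet's theorem this property depends only on the caustic. The symbol $\sim$ denotes linear equivalence of divisors on the projective completion of $\mathscr{C}$. *)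

(* Defs.v *)
From HB Require Import structures.
From mathcomp Require Import all_boot all_order all_algebra.
From mathcomp Require Import qfpoly.
From mathcomp Require Import complex.
From mathcomp Require Import reals trigo.
From mathcomp Require Import freeg.
Set Implicit Arguments.
Unset Strict Implicit.
Unset Printing Implicit Defensive.
Import Order.TTheory GRing.Theory Num.Theory.
Local Open Scope ring_scope.

Section Billiard.
Variable R : realType.
Implicit Types (a b l : R) (u v p q r : R * R).

Definition dot u v : R := u.1 * v.1 + u.2 * v.2.
Definition enorm u : R := Num.sqrt (dot u u).

(* Unoriented angle, in [0, pi]; only meaningful for nonzero u and v. *)
Definition angle u v : R := acos (dot u v / (enorm u * enorm v)).

(* The homogeneous point (x : y : z) lies on the projective closure of the
   conic C_l of the confocal family; C_0 is the ellipse E. *)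
Definition on_conic a b l (x y z : R) : Prop :=
  x ^+ 2 / (a - l) + y ^+ 2 / (b - l) = z ^+ 2.

Definition on_ellipse a b p : Prop := on_conic a b 0 p.1 p.2 1.

(* The line through the distinct points p and q is the tangent line of C_l at
   one of its points (x : y : z).  The point may be at infinity (z = 0), so the
   asymptotes of a hyperbola are among its tangents. *)
Definition tangent_to_conic a b l p q : Prop :=
  exists x y z : R,
    [/\ (x, y, z) <> (0, 0, 0), on_conic a b l x y z,
        x * p.1 / (a - l) + y * p.2 / (b - l) = z
      & x * q.1 / (a - l) + y * q.2 / (b - l) = z].

(* A direction vector of the tangent line of the ellipse at q. *)
Definition tangent_dir a b q : R * R := (- (q.2 / b), q.1 / a).

(* The path p -> q -> r makes equal angles with the tangent at q before and
   after the bounce.  The angles are measured with one oriented tangent vector,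
   and q - p crosses it outwards while r - q crosses it inwards, so this
   determines the direction of r - q. *)
Definition reflection_law a b p q r : Prop :=
  angle (q - p) (tangent_dir a b q) = angle (r - q) (tangent_dir a b q).

Definition billiard_trajectory a b (p : nat -> R * R) : Prop :=
  [/\ forall k, on_ellipse a b (p k),
      forall k, p k <> p k.+1
    & forall k, reflection_law a b (p k) (p k.+1) (p k.+2)].

Definition has_caustic a b l (p : nat -> R * R) : Prop :=
  forall k, tangent_to_conic a b l (p k) (p k.+1).

Definition n_periodic (n : nat) (p : nat -> R * R) : Prop :=
  forall k, p (k + n)%N = p k.

End Billiard.

Section FunctionField.
Variables (K : fieldType) (a b l : K).

Definition cubic : {poly K} := (a%:P - 'X) * (b%:P - 'X) * (l%:P - 'X).

Definition weierstrass : {poly {fraction {poly K}}} :=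
  'X^2 - (tofrac cubic)%:P.

Lemma size_cubic : size cubic = 4.
Proof.
have sX (c : K) : c%:P - 'X = - ('X - c%:P) by rewrite opprB.
rewrite /cubic !sX mulrNN mulrN size_polyN.
rewrite size_Mmonic ?monicXsubC ?mulf_neq0 ?polyXsubC_eq0 //.
by rewrite size_Mmonic ?monicXsubC ?polyXsubC_eq0 // !size_XsubC.
Qed.

Lemma cubic_not_square (r : {fraction {poly K}}) : r ^+ 2 != tofrac cubic.
Proof.
have [p [q [q0 rq]]] : exists p q : {poly K},
    q != 0 /\ r * tofrac q = tofrac p.
  elim/quotW: r => x; exists (frac x).1, (frac x).2; split.
    exact: denom_ratioP.
  unlock tofrac; rewrite -[LHS]FracField.pi_mul; apply/eqmodP.
  rewrite /= FracField.equivfE /FracField.mulf.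
  by rewrite !numden_Ratio ?mulf_neq0 ?oner_eq0 ?denom_ratioP // !mulr1 mulrC.
apply/eqP => e.
have /eqP : tofrac (p ^+ 2) = tofrac (cubic * q ^+ 2).
  by rewrite tofracXn [RHS]tofracM tofracXn -rq -e exprMn.
rewrite tofrac_eq => /eqP epq.
have c0 : cubic != 0 by rewrite -size_poly_gt0 size_cubic.
have p0 : p != 0.
  by apply: contraNneq (mulf_neq0 c0 (expf_neq0 2 q0)) => p0; rewrite -epq p0 expr0n.
have := congr1 (fun s : {poly K} => odd (size s)) epq.
rewrite /= !expr2 (size_mul p0 p0) (size_mul c0 (mulf_neq0 q0 q0)).
rewrite (size_mul q0 q0) size_cubic.
by move: p0 q0; rewrite -!size_poly_gt0; case: size => // m; case: size => // k;
  rewrite !addSn !addnS /= !addnn /= !odd_double.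
Qed.

Lemma weierstrass_irr : monic_irreducible_poly weierstrass.
Proof.
have sz : size weierstrass = 3 by exact: size_XnsubC.
split; last by exact: monicXnsubC.
apply: cubic_irreducible; first by rewrite sz.
by move=> r; rewrite /root !hornerE subr_eq0 cubic_not_square.
Qed.

(* K(x)[y] / (y^2 - (a - x)(b - x)(l - x)). *)
Definition funfield : Type := {poly %/ weierstrass with weierstrass_irr}.
HB.instance Definition _ := GRing.Field.on funfield.

Definition fun_const (c : K) : funfield := qpolyC weierstrass (tofrac c%:P).
Definition fun_x : funfield := qpolyC weierstrass (tofrac 'X).
Definition fun_y : funfield := qpolyX weierstrass.

(* The points of the projective completion: the affine points, and [None] for
   its only point at infinity, (0 : 1 : 0). *)
Definition on_curve (P : option (K * K)) : bool :=
  if P is Some (x, y) then y ^+ 2 == (a - x) * (b - x) * (l - x) else true.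

Definition curve : Type := {P : option (K * K) | on_curve P}.
HB.instance Definition _ := Choice.on curve.

Definition abscissa (P : curve) : option K := omap fst (val P).

(* Coordinates, centred at P, of an affine chart of the projective plane
   containing P; the chart at infinity is (X/Y, Z/Y). *)
Definition chart (P : curve) : funfield * funfield :=
  if val P is Some (x0, y0) then (fun_x - fun_const x0, fun_y - fun_const y0)
  else (fun_x / fun_y, fun_y^-1).

Definition eval2 (P : curve) (G : {poly {poly K}}) : funfield :=
  (map_poly (map_poly fun_const) G).[(chart P).1, (chart P).2].

(* h lies in the local ring of the curve at P. *)
Definition regular_at (P : curve) (h : funfield) : Prop :=
  exists G H : {poly {poly K}}, H.[0, 0] != 0 /\ h = eval2 P G / eval2 P H.

Definition unit_at (P : curve) (h : funfield) : Prop :=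
  [/\ h != 0, regular_at P h & regular_at P h^-1].

(* h lies in the maximal ideal of the local ring at P. *)
Definition vanishes_at (P : curve) (h : funfield) : Prop :=
  regular_at P h /\ ~ unit_at P h.

Definition uniformizer_at (P : curve) (t : funfield) : Prop :=
  vanishes_at P t /\
  forall h, vanishes_at P h -> exists2 g, regular_at P g & h = t * g.

Definition order_at (P : curve) (h : funfield) (k : int) : Prop :=
  exists t u, [/\ uniformizer_at P t, unit_at P u & h = u * t ^ k].

Definition divisor : Type := {freeg curve / int}.
HB.instance Definition _ := GRing.Zmodule.on divisor.

(* D is the divisor of the rational function h.  Only points with coordinates
   in K are seen, which is the usual notion when K is algebraically closed. *)
Definition is_div (h : funfield) (D : divisor) : Prop :=
  forall P : curve, order_at P h (coeff P D).

Definition lin_equiv (D1 D2 : divisor) : Prop :=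
  exists2 h : funfield, h != 0 & is_div h (D1 - D2).

Definition point_div (P : curve) : divisor := << P >>.

End FunctionField.

(* Main.v *)
(** In the inverse spectral variable [z = 1 / x], one bounce of the billiard acts
   on the pair of two consecutive vertices through a 2 x 2 matrix [T] that is
   affine in [z], and conjugates the matrix [L] of the confocal pencil restricted
   to the chord, whose square is the scalar [z (az - 1) (bz - 1) (lz - 1)].  If
   the trajectory closes after [n] bounces, the product [N] of the [n] matrices
   commutes with [L], hence [N = u + t L] with [u ^ 2 - t ^ 2 L ^ 2 = 1]; the
   values of [u] at [0], [1 / a] and [1 / b] record that both coordinates return
   with the right signs.  Conversely [u + t L] must be equal to [N] by comparing
   leading terms at [z = oo].  Writing the coprime factors [u - 1] and [u + 1] as
   squares up to branch points turns this Pell equation into the identity that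
   says that [p + q y] has divisor [n Q_0 - n Q_l], up to a power of [l - x]. *)

(* Three values of [z] matter because the abscissas, the ordinates and the constant 1 obey one and
   the same three-term recurrence along a trajectory, taken at [z = 1 / a], [1 / b] and [0]. There
   the confocal form degenerates to rank one, [L] kills the corresponding row, and [N = u + t L]
   acts on it as [u] alone. The sign of [u] at the fourth branch point [1 / l] stays free; it is 1
   for [n] even and -1 for [n] odd, whence the two shapes of [cayley]. The two implications are
   asymmetric. From periodicity, one well chosen trajectory is enough, but it has to be constructed,
   since the billiard side is a universally quantified statement. Conversely every trajectory must
   be treated; shifting its origin reduces the claim to [p n = p 0]. The geometry is real while the
   extraction of squares requires a closed field, so the trajectory data are transported along a
   field morphism before any spectral argument. *)
Require Import Defs.
From HB Require Import structures.
From mathcomp Require Import all_boot all_order all_algebra.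
From mathcomp Require Import qfpoly freeg complex boolp reals trigo.
From mathcomp Require Import ring lra zify.
Set Implicit Arguments.
Unset Strict Implicit.
Unset Printing Implicit Defensive.
Import Order.TTheory GRing.Theory Num.Theory.
Local Open Scope ring_scope.

(** * Local rings of plane curves *)

Section LocalRing.
Variables (K L : fieldType) (k : {rmorphism K -> L}) (r s : L).

Definition local_eval (G : {poly {poly K}}) : L := (map_poly (map_poly k) G).[r, s].
Local Notation ev := local_eval.

(** The scalar [c] is the residue of [h] at the point. Tracking it turns regularity, invertibility
    and membership in the maximal ideal into statements about one element of [K]. *)
Definition has_value (h : L) (c : K) : Prop :=
  exists G H : {poly {poly K}},
    [/\ H.[0, 0] != 0, h = ev G / ev H & c = G.[0, 0] / H.[0, 0]].

Definition regular (h : L) : Prop :=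
  exists G H : {poly {poly K}}, H.[0, 0] != 0 /\ h = ev G / ev H.
Definition local_unit (h : L) : Prop := [/\ h != 0, regular h & regular h^-1].
Definition in_max (h : L) : Prop := regular h /\ ~ local_unit h.
Definition uniformizer (t : L) : Prop :=
  in_max t /\ forall h, in_max h -> exists2 g, regular g & h = t * g.
Definition has_order (h : L) (n : int) : Prop :=
  exists t u, [/\ uniformizer t, local_unit u & h = u * t ^ n].

(** Every relation between the coordinates [r] and [s] holds at the point itself; this is what makes
    the residue unique. It is established separately for affine points and for infinity. *)
Hypothesis ev_eq0 : forall G, ev G = 0 -> G.[0, 0] = 0.

Lemma ev_neq0 G : G.[0, 0] != 0 -> ev G != 0.
Proof. by apply: contra_neq; exact: ev_eq0. Qed.

Let evD G H : ev (G + H) = ev G + ev H.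
Proof. by rewrite /local_eval rmorphD !hornerD. Qed.
Let evM G H : ev (G * H) = ev G * ev H.
Proof. by rewrite /local_eval rmorphM !hornerM. Qed.
Let ev1 : ev 1 = 1.
Proof. by rewrite /local_eval rmorph1 !hornerE. Qed.

Lemma regularP h : regular h <-> exists c, has_value h c.
Proof.
split=> [[G [H [H0 hE]]]|[c [G [H [H0 hE _]]]]]; last by exists G, H.
by exists (G.[0, 0] / H.[0, 0]), G, H.
Qed.

Lemma has_value_regular h c : has_value h c -> regular h.
Proof. by move=> hc; apply/regularP; exists c. Qed.

Lemma has_valueC c : has_value (k c) c.
Proof.
exists c%:P%:P, 1; rewrite ev1 !hornerE oner_eq0 !divr1; split=> //.
by rewrite /local_eval map_polyC hornerC /= map_polyC hornerC.
Qed.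

Lemma has_value1 : has_value 1 1.
Proof. by rewrite -{1}(rmorph1 k); exact: has_valueC. Qed.

Lemma has_valueD h c h' c' :
  has_value h c -> has_value h' c' -> has_value (h + h') (c + c').
Proof.
move=> [G [H [H0 -> ->]]] [G' [H' [H'0 -> ->]]].
exists (G * H' + G' * H), (H * H').
rewrite !(evD, evM) !(hornerD, hornerM) mulf_neq0 //; split=> //.
  by rewrite addf_div // ev_neq0.
by rewrite addf_div.
Qed.

Lemma has_valueM h c h' c' :
  has_value h c -> has_value h' c' -> has_value (h * h') (c * c').
Proof.
move=> [G [H [H0 -> ->]]] [G' [H' [H'0 -> ->]]].
exists (G * G'), (H * H').
by rewrite !evM !hornerM mulf_neq0 //; split=> //; rewrite mulf_div.
Qed.

Lemma has_valueN h c : has_value h c -> has_value (- h) (- c).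
Proof.
rewrite -(mulN1r h) -(mulN1r c) -{1}(rmorphN1 k) => hc.
by apply: has_valueM => //; apply: has_valueC.
Qed.

Lemma has_valueB h c h' c' :
  has_value h c -> has_value h' c' -> has_value (h - h') (c - c').
Proof. by move=> hc hc'; apply: has_valueD => //; apply: has_valueN. Qed.

Lemma has_valueX h c n : has_value h c -> has_value (h ^+ n) (c ^+ n).
Proof.
move=> hc; elim: n => [|n IH]; first exact: has_value1.
by rewrite !exprS; apply: has_valueM.
Qed.

Lemma has_valueV h c : c != 0 -> has_value h c -> has_value h^-1 c^-1.
Proof.
move=> c0 [G [H [H0 -> cE]]]; exists H, G; rewrite !invf_div cE invf_div.
by split=> //; apply: contraNneq c0 => e; rewrite cE e mul0r.
Qed.

Lemma has_value_inj h c c' : has_value h c -> has_value h c' -> c = c'.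
Proof.
move=> hc hc'; have := has_valueB hc hc'; rewrite subrr => -[G [H [H0 e E]]].
apply/eqP; rewrite -subr_eq0 E ev_eq0 ?mul0r //.
have /eqP := esym e; rewrite mulf_eq0 invr_eq0 => /orP[/eqP //|].
by rewrite (negPf (ev_neq0 H0)).
Qed.

Lemma has_value_poly (p : {poly K}) h c :
  has_value h c -> has_value (map_poly k p).[h] p.[c].
Proof.
move=> hc; elim/poly_ind: p => [|p e IH].
  by rewrite rmorph0 !horner0 -{1}(rmorph0 k); apply: has_valueC.
rewrite rmorphD rmorphM /= map_polyX map_polyC /= !hornerE.
by apply: has_valueD; [apply: has_valueM | apply: has_valueC].
Qed.

Lemma has_value_neq0 h c : c != 0 -> has_value h c -> h != 0.
Proof.
move=> c0 hc; apply: contra_neq c0 => h0; apply: has_value_inj hc _.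
by rewrite h0 -{1}(rmorph0 k); apply: has_valueC.
Qed.

Lemma local_unitP h : local_unit h <-> exists2 c, c != 0 & has_value h c.
Proof.
split=> [[h0 /regularP[c hc] /regularP[c' hc']]|[c c0 hc]].
  exists c => //; apply/eqP => c0; have := has_valueM hc hc'.
  rewrite divff // c0 mul0r => /(has_value_inj has_value1)/eqP.
  by rewrite oner_eq0.
split; last by apply/regularP; exists c^-1; apply: has_valueV.
  exact: has_value_neq0 hc.
by apply/regularP; exists c.
Qed.

Lemma in_maxP h : in_max h <-> has_value h 0.
Proof.
split=> [[/regularP[c hc] nu]|h0].
  have [<- //|c0] := eqVneq c 0; case: nu; apply/local_unitP; by exists c.
split; first by apply/regularP; exists 0.
by move/local_unitP => [c c0 /(has_value_inj h0)/eqP]; rewrite eq_sym (negPf c0).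
Qed.

Lemma has_value_r : has_value r 0.
Proof.
exists 'X, 1; rewrite ev1 hornerX !hornerC oner_eq0 !divr1; split=> //.
by rewrite /local_eval map_polyX hornerX hornerC.
Qed.

Lemma has_value_s : has_value s 0.
Proof.
exists 'X%:P, 1; rewrite ev1 !hornerC hornerX oner_eq0 !divr1; split=> //.
by rewrite /local_eval map_polyC hornerC /= map_polyX hornerX.
Qed.

(* A polynomial without constant term is [r * _ + s * _]. *)
Lemma uniformizerI t g1 c1 g2 c2 : has_value t 0 ->
  has_value g1 c1 -> has_value g2 c2 -> r = t * g1 -> s = t * g2 ->
  uniformizer t.
Proof.
move=> t0 v1 v2 rE sE; split; first exact/in_maxP.
move=> h /in_maxP[G [H [H0 -> /esym/eqP]]].
rewrite mulf_eq0 invr_eq0 (negPf H0) orbF => /eqP G0.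
have ex (p : {poly {poly K}}) : exists2 g, regular g &
    ev p = k p.[0, 0] + t * g.
  have kr c : has_value (k c) c by apply: has_valueC.
  have ex1 (q : {poly K}) : exists2 g, regular g &
      (map_poly k q).[s] = k q.[0] + t * g.
    elim/poly_ind: q => [|q e _].
      exists 0; last by rewrite !rmorph0 !horner0 rmorph0 mulr0 addr0.
      by rewrite -(rmorph0 k); apply: has_value_regular (kr _).
    exists ((map_poly k q).[s] * g2).
      by apply: (has_value_regular (has_valueM (has_value_poly q has_value_s) v2)).
    rewrite rmorphD rmorphM /= map_polyX map_polyC !hornerMXaddC mulr0 add0r.
    by rewrite mulrCA -sE addrC.
  elim/poly_ind: p => [|p e _].
    exists 0; last by rewrite /local_eval !rmorph0 !horner0 rmorph0 mulr0 addr0.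
    by rewrite -(rmorph0 k); apply: has_value_regular (kr _).
  have [g /regularP[c gc] ge] := ex1 e.
  exists (ev p * g1 + g).
    apply/regularP; exists (p.[0, 0] * c1 + c); apply: has_valueD => //.
    apply: has_valueM => //; exists p, 1.
    by rewrite ev1 !hornerC oner_eq0 !divr1.
  rewrite /local_eval rmorphD rmorphM /= map_polyX map_polyC !hornerMXaddC.
  by rewrite mulr0 add0r hornerD hornerM hornerC /= ge rE; ring.
have [g gr ge] := ex G.
exists (g / ev H); last by rewrite ge G0 rmorph0 add0r mulrA.
have [c gc] := (regularP g).1 gr; apply/regularP; exists (c / H.[0, 0]).
apply: has_valueM => //; apply: has_valueV => //.
by exists H, 1; rewrite ev1 !hornerE oner_eq0 !divr1.
Qed.

Lemma uniformizer_assoc t t' : t' != 0 ->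
  uniformizer t -> uniformizer t' ->
  exists2 u, local_unit u & t' = u * t.
Proof.
move=> t'0 [mt dt] [mt' dt'].
have [g gr gE] := dt _ mt'; have [g' gr' gE'] := dt' _ mt.
have t0 : t != 0 by apply: contraNneq t'0 => e; rewrite gE e mul0r.
exists g; last by rewrite mulrC.
have e : g * g' = 1.
  by apply: (mulfI t0); rewrite mulrA -gE -gE' mulr1.
have g0 : g != 0 by apply: contraNneq t'0 => e'; rewrite gE e' mulr0.
split=> //; suff -> : g^-1 = g' by [].
by apply: (mulfI g0); rewrite divff.
Qed.

(** [has_order] hides an unspecified uniformizer. Two uniformizers differ by a unit, so it can be
    traded for a chosen one, with which explicit computation is possible. *)
Lemma has_order_uniformizer t h n : t != 0 -> uniformizer t -> has_order h n ->
  exists u c, [/\ c != 0, has_value u c & h = u * t ^ n].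
Proof.
move=> t0 ut [t' [u' [ut' /local_unitP[c' c'0 vu'] ->]]].
have [v lv tE] := uniformizer_assoc t0 ut' ut.
have [v0 _ _] := lv; have /local_unitP[d d0 vd] := lv.
have -> : t' = v^-1 * t by rewrite tE mulKf.
have vw := has_valueV d0 vd.
exists (u' * v^-1 ^ n), (c' * d^-1 ^ n).
rewrite mulf_neq0 ?expfz_neq0 ?invr_eq0 // exprMz_comm ?unitfE ?invr_eq0 //; last first.
  by rewrite /GRing.comm mulrC.
split; rewrite ?mulrA //; apply: has_valueM => //.
case: n => n; first exact: has_valueX.
by apply: has_valueV; rewrite ?expf_neq0 ?invr_eq0 //; exact: has_valueX.
Qed.

Lemma has_orderI t h u c n : uniformizer t -> c != 0 -> has_value u c ->
  h = u * t ^ n -> has_order h n.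
Proof. by move=> ut c0 vu hE; exists t, u; split=> //; apply/local_unitP; exists c. Qed.

End LocalRing.

(** * The curve in an abstract function field *)

Section Horner2.
Variables (K L : fieldType) (k : {rmorphism K -> L}).

(** A relation between [L] and [K] that respects constants, sums and products extends from the two
    coordinates to every polynomial in them. With a suitable [Q] this yields the kernel condition
    [ev_eq0], at affine points and at infinity. *)
Lemma horner2_ind (Q : L -> K -> Prop) :
    (forall c, Q (k c) c) ->
    (forall h c h' c', Q h c -> Q h' c' -> Q (h + h') (c + c')) ->
    (forall h c h' c', Q h c -> Q h' c' -> Q (h * h') (c * c')) ->
  forall r s c d, Q r c -> Q s d ->
  forall G : {poly {poly K}},
  Q (map_poly (map_poly k) G).[r, s] G.[c, d].
Proof.
move=> Qc QD QM r s c d Qr Qs.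
have Q1 (p : {poly K}) : Q (map_poly k p).[s] p.[d].
  elim/poly_ind: p => [|p e IH]; first by rewrite rmorph0 !horner0 -{1}(rmorph0 k).
  rewrite rmorphD rmorphM /= map_polyX map_polyC /= !hornerE.
  by apply: QD => //; apply: QM.
elim/poly_ind => [|G e IH].
  by rewrite rmorph0 !horner0 -{1}(rmorph0 k).
rewrite rmorphD rmorphM /= map_polyX map_polyC /= !hornerE.
by apply: QD => //; apply: QM.
Qed.

End Horner2.

(* [A ^+ 2 - B ^+ 2 * c] for [n] even, and its analogue with the branch point
   [l] absorbed in the first square for [n] odd. *)
Definition cayley (K : fieldType) (a b l : K) (n : nat) : Prop :=
  exists (A B : {poly K}) (c : K), [/\ c != 0, A.[0] != 0 &
    (if odd n then (l%:P - 'X) * A ^+ 2 - B ^+ 2 * ((a%:P - 'X) * (b%:P - 'X))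
     else A ^+ 2 - B ^+ 2 * ((a%:P - 'X) * (b%:P - 'X) * (l%:P - 'X)))
    = c%:P * 'X^n].

Lemma closed_sqrt (K : closedFieldType) (v : K) : exists w, w ^+ 2 = v.
Proof.
have /closed_rootP[w] : size ('X^2 - v%:P) != 1%N by rewrite size_XnsubC.
by rewrite /root !hornerE subr_eq0 => /eqP; exists w.
Qed.

Section Curve.
Variables (K : closedFieldType) (a b l : K) (L : fieldType).
Variables (k : {rmorphism K -> L}) (fp : {rmorphism {poly K} -> L}) (Y : L).

Variable cub : {poly K}.
Local Notation X := (fp 'X).

Hypothesis cubE : cub = (a%:P - 'X) * (b%:P - 'X) * (l%:P - 'X).
Hypothesis two : (2%:R : K) != 0.
Hypotheses (ab : a != b) (al : a != l) (bl : b != l).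
Hypotheses (a0 : a != 0) (b0 : b != 0) (l0 : l != 0).
Hypothesis kE : forall c, k c = fp c%:P.
Hypothesis Y2 : Y ^+ 2 = fp cub.
(** With [fp_indep], this says that [L] has basis [1, Y] over [K(x)]. The section argues only from
    this interface, so the quotient construction of [funfield] intervenes only where the interface
    is instantiated. *)
Hypothesis fp_decomp : forall h : L, exists p q d : {poly K},
  d != 0 /\ h * fp d = fp p + fp q * Y.
Hypothesis fp_indep : forall p q : {poly K},
  fp p + fp q * Y = 0 -> p = 0 /\ q = 0.

Lemma fp_eq0 p : (fp p == 0) = (p == 0).
Proof.
apply/eqP/eqP => [p0|->]; last exact: rmorph0.
by have [] := @fp_indep p 0; rewrite // p0 rmorph0 mul0r addr0.
Qed.

Lemma cub_at c : cub.[c] = (a - c) * (b - c) * (l - c).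
Proof. by rewrite cubE !hornerE. Qed.

Lemma cub_neq0 : cub != 0.
Proof.
apply/eqP => c0; have := cub_at 0; rewrite c0 horner0 !subr0 => /esym/eqP.
by rewrite !mulf_eq0 (negPf a0) (negPf b0) (negPf l0).
Qed.

Lemma X_neq0 : X != 0. Proof. by rewrite fp_eq0 polyX_eq0. Qed.
Lemma Y_neq0 : Y != 0.
Proof.
have : fp cub != 0 by rewrite fp_eq0 cub_neq0.
by rewrite -Y2; apply: contra_neq => ->; rewrite expr0n.
Qed.

Lemma map_horner_X p : (map_poly k p).[X] = fp p.
Proof.
elim/poly_ind: p => [|p e IH]; first by rewrite !rmorph0 horner0.
by rewrite rmorphD rmorphM /= map_polyX map_polyC hornerMXaddC IH /= kE rmorphD rmorphM.
Qed.

Lemma fp_cub : fp cub = (k a - X) * (k b - X) * (k l - X).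
Proof. by rewrite cubE !rmorphM /= !rmorphB /= -!kE. Qed.

(** * Local rings at the affine points *)

Section Affine.
Variables (x0 y0 : K).
Hypothesis onC : y0 ^+ 2 = (a - x0) * (b - x0) * (l - x0).
Local Notation r := (X - k x0).
Local Notation s := (Y - k y0).
Local Notation val := (has_value k r s).

Lemma affine_ev_eq0 G : local_eval k r s G = 0 -> G.[0, 0] = 0.
Proof.
(* [Q] pairs an element of the coordinate ring with its value at [(x0, y0)]; compatibility with
   products is exactly the equation of the curve. *)
pose Q (h : L) c := exists p q, h = fp p + fp q * Y /\ c = p.[x0] + q.[x0] * y0.
suff [p [q [-> ->]]] : Q (local_eval k r s G) G.[0, 0].
  by move=> /fp_indep[-> ->]; rewrite !horner0 mul0r addr0.
apply: horner2_ind => [c|h c h' c'|h c h' c'||].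
- by exists c%:P, 0; rewrite rmorph0 horner0 hornerC !mul0r !addr0 kE.
- move=> [p [q [-> ->]]] [p' [q' [-> ->]]]; exists (p + p'), (q + q').
  by rewrite !rmorphD !hornerD; split; ring.
- move=> [p [q [-> ->]]] [p' [q' [-> ->]]].
  exists (p * p' + q * q' * cub), (p * q' + q * p').
  rewrite !(rmorphD, rmorphM) /= -Y2 !(hornerD, hornerM) cub_at -onC.
  by split; ring.
- exists ('X - x0%:P), 0.
  by rewrite rmorphB rmorph0 /= -kE !hornerE subrr; split; rewrite ?mul0r ?addr0.
exists (- y0%:P), 1.
by rewrite rmorphN rmorph1 /= -kE !hornerE addNr addrC.
Qed.
Let ev0 G : local_eval k r s G = 0 -> G.[0, 0] = 0.
Proof. exact: affine_ev_eq0. Qed.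

Lemma val_poly p : val (fp p) p.[x0].
Proof.
rewrite -(map_horner_X p); apply: has_value_poly => //.
have := has_valueD ev0 (has_value_r k r s) (has_valueC k r s x0).
by rewrite subrK add0r.
Qed.

Lemma val_Y : val Y y0.
Proof.
have := has_valueD ev0 (has_value_s k r s) (has_valueC k r s y0).
by rewrite subrK add0r.
Qed.

Lemma val_polyY p q : val (fp p + fp q * Y) (p.[x0] + q.[x0] * y0).
Proof.
apply: has_valueD => //; first exact: val_poly.
by apply: has_valueM => //; [exact: val_poly | exact: val_Y].
Qed.

(** The product [(Y - y0) (Y + y0)] equals [cub - cub(x0)], a multiple of [X - x0], and [Y + y0] is
    a unit because its value is [2 y0]. *)
Lemma uniformizer_X : y0 != 0 -> uniformizer k r s r.
Proof.
move=> y00; have : root (cub - (cub.[x0])%:P) x0.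
  by rewrite /root !hornerE subrr.
move=> /factor_theorem[q /(congr1 fp)]; rewrite rmorphM !rmorphB /= => e.
have v1 : val (Y + k y0) (y0 + y0).
  by apply: has_valueD => //; [exact: val_Y | exact: has_valueC].
have n2 : y0 + y0 != 0 by rewrite -mulr2n -mulr_natl mulf_neq0.
apply: (@uniformizerI _ _ k r s _ r 1 1 (fp q / (Y + k y0)) (q.[x0] / (y0 + y0))).
- exact: ev0.
- exact: has_value_r.
- exact: has_value1.
- by apply: has_valueM => //; [exact: val_poly | exact: has_valueV].
- by rewrite mulr1.
have n0 : Y + k y0 != 0.
  apply: contraNneq n2 => e0; apply/eqP.
  by apply: has_value_inj v1 _ => //; rewrite e0 -(rmorph0 k); apply: has_valueC.
apply: (mulIf n0); rewrite -mulrA divfK // [r * _]mulrC (kE x0) -e.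
by rewrite -Y2 cub_at -onC -kE rmorphXn; ring.
Qed.

(** The root is simple because [a], [b], [l] are distinct: the value of the cofactor is the
    derivative of [cub] at [x0]. *)
Lemma branch_factor : y0 = 0 -> exists2 q, q.[x0] != 0 &
  cub = q * ('X - x0%:P).
Proof.
move=> y00; have : root cub x0 by rewrite /root cub_at -onC y00 expr0n.
move=> /factor_theorem[q e]; exists q => //.
have := congr1 (fun p => p^`().[x0]) e.
rewrite cubE !derivE !hornerE /= subrr mulr0 add0r => <-.
have := onC; rewrite y00 expr0n /= => /esym/eqP; rewrite !mulf_eq0 !subr_eq0.
have nz (u v w : K) : v != u -> w != u -> (v - u) * (w - u) != 0.
  by move=> h1 h2; rewrite mulf_neq0 // subr_eq0.
move=> /orP[/orP[]|] /eqP <-.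
- by rewrite -oppr_eq0; apply: contra_neq (nz a b l _ _) => [<-||]; [ring|rewrite eq_sym..].
- by rewrite -oppr_eq0; apply: contra_neq (nz b a l _ _) => [<-||]; [ring|..|rewrite eq_sym].
by rewrite -oppr_eq0; apply: contra_neq (nz l a b _ _) => [<-||]; [ring|..].
Qed.

Lemma branch_X : y0 = 0 -> exists w c,
  [/\ c != 0, val w c & r = Y ^+ 2 * w].
Proof.
move=> y00; have [q q0 e] := branch_factor y00; exists (fp q)^-1, (q.[x0])^-1.
have n0 : fp q != 0.
  by rewrite fp_eq0; apply: contraNneq q0 => ->; rewrite horner0.
rewrite invr_eq0; split=> //; first by apply: has_valueV => //; exact: val_poly.
by rewrite Y2 e rmorphM rmorphB /= mulrC mulKf // kE.
Qed.

Lemma uniformizer_Y : y0 = 0 -> uniformizer k r s Y.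
Proof.
move=> y00; have [w [c [c0 vw e]]] := branch_X y00.
apply: (@uniformizerI _ _ k r s _ Y (Y * w) (y0 * c) 1 1) => //.
- by rewrite -y00; exact: val_Y.
- by apply: has_valueM => //; exact: val_Y.
- exact: has_value1.
- by rewrite mulrA -expr2.
by rewrite mulr1 y00 rmorph0 subr0.
Qed.

End Affine.

(** * The local ring at infinity *)

Section Infinity.
Local Notation r := (X / Y).
Local Notation s := (Y^-1).
Local Notation val := (has_value k r s).

Lemma size_cub : size cub = 4.
Proof.
have sX (c : K) : c%:P - 'X = - ('X - c%:P) by rewrite opprB.
rewrite cubE !sX mulrNN mulrN size_polyN.
rewrite size_Mmonic ?monicXsubC ?mulf_neq0 ?polyXsubC_eq0 //.
by rewrite size_Mmonic ?monicXsubC ?polyXsubC_eq0 // !size_XsubC.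
Qed.

(* [Q h c] says that [h - c] has a zero at infinity; in terms of the pole orders
   2 of [X] and 3 of [Y], its numerator [p + q Y] has a smaller pole than its
   denominator [d]. *)
Lemma infinity_ev_eq0 G : local_eval k r s G = 0 -> G.[0, 0] = 0.
Proof.
pose Q (h : L) c := exists p q d : {poly K},
  [/\ d != 0, (h - k c) * fp d = fp p + fp q * Y,
      (size p < size d)%N & ((size q).+1 < size d)%N].
suff [p [q [d [d0 e sp sq]]]] : Q (local_eval k r s G) G.[0, 0].
  move=> G0; have : fp (p + G.[0, 0]%:P * d) + fp q * Y = 0.
    by rewrite rmorphD rmorphM /= -kE addrAC -e G0; ring.
  move=> /fp_indep[/eqP + _]; rewrite addr_eq0 mul_polyC => /eqP pE.
  apply/eqP; apply: contraLR sp => c0.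
  by rewrite pE size_polyN size_scale // ltnn.
have sD (u v : {poly K}) m : (size u <= m)%N -> (size v <= m)%N ->
    (size (u + v)%R <= m)%N.
  by move=> su sv; rewrite (leq_trans (size_polyD _ _)) // geq_max su sv.
have sM (u v : {poly K}) i j m : (size u <= i)%N -> (size v <= j)%N ->
    (i + j <= m.+1)%N -> (size (u * v)%R <= m)%N.
  move=> ui vj ijm; apply: leq_trans (size_polyMleq _ _) _.
  by rewrite -subn1 leq_subLR add1n; apply: leq_trans (leq_add ui vj) ijm.
have sZ (c : K) (u : {poly K}) m : (size u <= m)%N -> (size (c%:P * u)%R <= m)%N.
  by rewrite mul_polyC; apply/leq_trans/size_scale_leq.
have dS (q d : {poly K}) : ((size q).+1 < size d)%N -> exists n, size d = n.+2.
  by case: (size d) => [|[|n]] // _; exists n.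
apply: horner2_ind => [c|h c h' c'|h c h' c'||].
- exists 0, 0, 'X; rewrite polyX_eq0 subrr mul0r !rmorph0 mul0r addr0.
  by rewrite size_polyX size_poly0.
- move=> [p [q [d [d0 e sp sq]]]] [p' [q' [d' [d'0 e' sp' sq']]]].
  exists (p * d' + p' * d), (q * d' + q' * d), (d * d').
  have [n sd] := dS _ _ sq; have [n' sd'] := dS _ _ sq'.
  have sdd : size (d * d') = (n + n').+3 by rewrite (size_mul d0 d'0) sd sd'; clear; lia.
  rewrite sd ltnS in sp; rewrite sd' ltnS in sp'.
  rewrite sd !ltnS in sq; rewrite sd' !ltnS in sq'.
  have := eq_leq sd => {}sd; have := eq_leq sd' => {}sd'.
  rewrite mulf_neq0 // sdd !ltnS; split=> //.
  - rewrite !(rmorphD, rmorphM) /=.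
    have -> : (h + h' - (k c + k c')) * (fp d * fp d') =
      (h - k c) * fp d * fp d' + (h' - k c') * fp d' * fp d by ring.
    by rewrite e e'; ring.
  - by apply: (sD); [apply: sM sp sd' _ | apply: sM sp' sd _]; clear; lia.
  by apply: (sD); [apply: sM sq sd' _ | apply: sM sq' sd _]; clear; lia.
- move=> [p [q [d [d0 e sp sq]]]] [p' [q' [d' [d'0 e' sp' sq']]]].
  exists (p * p' + q * q' * cub + (c%:P * (p' * d) + c'%:P * (p * d'))),
    (p * q' + q * p' + (c%:P * (q' * d) + c'%:P * (q * d'))), (d * d').
  have [n sd] := dS _ _ sq; have [n' sd'] := dS _ _ sq'.
  have sdd : size (d * d') = (n + n').+3 by rewrite (size_mul d0 d'0) sd sd'; clear; lia.
  rewrite sd ltnS in sp; rewrite sd' ltnS in sp'.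
  rewrite sd !ltnS in sq; rewrite sd' !ltnS in sq'.
  have := eq_leq sd => {}sd; have := eq_leq sd' => {}sd'.
  have scub := eq_leq size_cub.
  have sqq : (size (q * q')%R <= (n + n').-1)%N by apply: sM sq sq' _; clear; lia.
  rewrite mulf_neq0 // sdd !ltnS; split=> //.
  - rewrite !(rmorphD, rmorphM) /= -Y2 -!kE.
    have -> : (h * h' - k c * k c') * (fp d * fp d') =
      ((h - k c) * fp d) * ((h' - k c') * fp d') +
      k c * ((h' - k c') * fp d') * fp d + k c' * ((h - k c) * fp d) * fp d' by ring.
    by rewrite e e'; ring.
  - apply: (sD); apply: (sD).
    + by apply: sM sp sp' _; clear; lia.
    + have [q0|q0] := eqVneq q 0; first by rewrite q0 !mul0r size_poly0.
      have n0 : (0 < n)%N by rewrite (leq_trans _ sq) // size_poly_gt0.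
      by apply: sM sqq scub _; move: n0; clear; lia.
    + by apply: (sZ); apply: sM sp' sd _; clear; lia.
    by apply: (sZ); apply: sM sp sd' _; clear; lia.
  apply: (sD); apply: (sD).
  + by apply: sM sp sq' _; clear; lia.
  + by apply: sM sq sp' _; clear; lia.
  + by apply: (sZ); apply: sM sq' sd _; clear; lia.
  by apply: (sZ); apply: sM sq sd' _; clear; lia.
- exists 0, 'X, cub; rewrite cub_neq0 size_cub size_polyX size_poly0; split=> //.
  by rewrite !rmorph0 subr0 add0r -Y2 expr2 mulrA divfK // Y_neq0.
exists 0, 1, cub; rewrite cub_neq0 size_cub size_poly1 size_poly0; split=> //.
by rewrite !rmorph0 subr0 add0r -Y2 expr2 rmorph1 mul1r mulKf // Y_neq0.
Qed.
Let ev0 G : local_eval k r s G = 0 -> G.[0, 0] = 0.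
Proof. exact: infinity_ev_eq0. Qed.

(* Dividing the equation of the curve by [Y ^+ 3] expresses [s] as [r ^+ 3]
   times a unit. *)
Lemma val_Xinv : val X^-1 0.
Proof.
have vr : val r 0 by exact: has_value_r.
have vs : val s 0 by exact: has_value_s.
have Y0 := Y_neq0; have X0 := X_neq0.
pose D := 1 - (k (a * b * l) * s ^+ 2 - k (a * b + a * l + b * l) * s * r +
  k (a + b + l) * r ^+ 2).
have vD : val D (1 - (a * b * l * 0 ^+ 2 - (a * b + a * l + b * l) * 0 * 0 +
   (a + b + l) * 0 ^+ 2)).
  have vC c : val (k c) c by exact: has_valueC.
  apply: has_valueB => //; first exact: has_value1.
  apply: has_valueD => //; last by apply: has_valueM => //; exact: has_valueX.
  by apply: has_valueB => //; do ?apply: has_valueM => //; exact: has_valueX.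
rewrite expr0n /= !mulr0 subrr addr0 subr0 in vD.
have e : s * D = - r ^+ 3.
  rewrite /D !(rmorphD, rmorphM) /=; apply/eqP.
  rewrite -subr_eq0 opprK; apply/eqP.
  have /eqP := Y2; rewrite fp_cub -subr_eq0 => /eqP e.
  apply: (mulfI (expf_neq0 3 Y0)); rewrite mulr0 -e.
  by field.
have D0 : D != 0.
  apply: contra_eq_neq e => ->; rewrite mulr0 eq_sym oppr_eq0 expf_eq0 /=.
  by rewrite mulf_neq0 // invr_eq0.
have -> : X^-1 = - r ^+ 2 * D^-1.
  have r0 : r != 0 by rewrite mulf_neq0 // invr_eq0.
  apply: (mulfI r0); apply: (mulIf D0); transitivity (s * D).
    by congr (_ * D); rewrite mulrAC divff // mul1r.
  by rewrite e -[RHS]mulrA divfK // mulrN -exprS.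
have v1 : (1 : K) != 0 by exact: oner_neq0.
have := has_valueM (has_valueN (has_valueX 2 vr)) (has_valueV v1 vD).
by rewrite expr0n oppr0 mul0r.
Qed.

Lemma uniformizer_infinity : uniformizer k r s r.
Proof.
apply: (@uniformizerI _ _ k r s _ r 1 1 X^-1 0) => //.
- exact: has_value_r.
- exact: has_value1.
- exact: val_Xinv.
- by rewrite mulr1.
by rewrite mulrAC divff ?X_neq0 // mul1r.
Qed.

(** Since [1 / X] vanishes at infinity, only the coefficient of degree [n] survives in the
    quotient. *)
Lemma val_poly_infinity (p : {poly K}) n :
  (size p <= n.+1)%N -> val (fp p / X ^+ n) p`_n.
Proof.
have vC c : val (k c) c by exact: has_valueC.
elim/poly_ind: p n => [|p c IH] n sp.
  by rewrite rmorph0 mul0r coef0 -(rmorph0 k).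
case: n sp => [|n] sp.
  rewrite expr0 divr1; have := size1_polyC sp; rewrite coefD coefMX coefC.
  by rewrite /= add0r => ->; rewrite -kE.
rewrite coefD coefMX coefC /= addr0 rmorphD rmorphM /= -kE mulrDl.
have -> : fp p * X / X ^+ n.+1 = fp p / X ^+ n.
  by rewrite exprS invfM mulrA mulfK // X_neq0.
have vX := has_valueM (vC c) (has_valueX n.+1 val_Xinv).
rewrite expr0n mulr0 exprVn in vX.
rewrite -[p`_n]addr0; apply: has_valueD vX => //.
apply: IH; move: sp; rewrite size_MXaddC.
by case: ifP => // /andP[/eqP -> _]; rewrite size_poly0.
Qed.

(** The pole of [q Y] has order [2 deg q + 3], below [2 n]. Writing [Y] as [cub / Y] exhibits the
    remaining factor [r], which vanishes. *)
Lemma val_polyY_infinity (q : {poly K}) n : (size q < n)%N -> val (fp q * Y / X ^+ n) 0.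
Proof.
have X0 := X_neq0; have Y0 := Y_neq0.
case: n => // -[|n] sq.
  move: sq; rewrite ltnS size_poly_leq0 => /eqP ->.
  by rewrite rmorph0 !mul0r -(rmorph0 k); apply: has_valueC.
have -> : fp q * Y / X ^+ n.+2 = fp q / X ^+ n * (fp cub / X ^+ 3 * r).
  rewrite -Y2 -addn2 exprD; have := expf_neq0 n X0.
  by move: (X ^+ n) => Z Z0; field; rewrite X0 Y0.
have vc : val (fp cub / X ^+ 3) cub`_3 by apply: val_poly_infinity; rewrite size_cub.
have := has_valueM (val_poly_infinity sq) (has_valueM vc (has_value_r k r s)).
by rewrite !mulr0.
Qed.

End Infinity.

Local Notation onC x0 y0 := (y0 ^+ 2 = (a - x0) * (b - x0) * (l - x0)).
Local Notation val_at x0 y0 := (has_value k (X - k x0) (Y - k y0)).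

Lemma fp_r c : fp ('X - c%:P) = X - k c.
Proof. by rewrite rmorphB /= kE. Qed.

Lemma r_neq0 c : X - k c != 0.
Proof. by rewrite -fp_r fp_eq0 polyXsubC_eq0. Qed.

(** The coordinate ring is the intersection of its local rings. At a root [x0] of the denominator
    the numerator vanishes at both points above [x0]; this forces [p] and [q] to vanish at [x0], and
    a linear factor cancels. *)
Lemma polynomial_of_regular g :
    (forall x0 y0, onC x0 y0 -> exists c, val_at x0 y0 g c) ->
  exists p q, g = fp p + fp q * Y.
Proof.
move=> reg; have [p [q [d [d0]]]] := fp_decomp g.
have [m] := ubnP (size d); elim: m p q d d0 => // m IH p q d d0 sd e.
have [/eqP/size_poly1P[c c0 dE]|/closed_rootP[x0]] := eqVneq (size d) 1%N.
  exists (c^-1%:P * p), (c^-1%:P * q).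
  have kc : k c != 0 by rewrite kE fp_eq0 polyC_eq0.
  apply: (mulIf kc); rewrite {1}kE -dE e !rmorphM /= -kE fmorphV.
  by rewrite mulrDl -!mulrA [(k c)^-1 * _]mulrC -!mulrA; field.
move=> /factor_theorem[d1 dE].
have E1 w : onC x0 w -> p.[x0] + q.[x0] * w = 0.
  move=> ow; have [c vc] := reg _ _ ow.
  have := has_valueM vc (val_poly ow d); rewrite e dE hornerM hornerXsubC.
  by rewrite subrr !mulr0 => /(has_value_inj (affine_ev_eq0 ow) (val_polyY ow p q)).
have [w ow] := closed_sqrt ((a - x0) * (b - x0) * (l - x0)).
have ow' : onC x0 (- w) by rewrite sqrrN.
have Ep := E1 _ ow; have Em := E1 _ ow'; rewrite mulrN in Em.
have p0 : p.[x0] = 0.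
  apply: (mulfI two); rewrite mulr0.
  transitivity ((p.[x0] + q.[x0] * w) + (p.[x0] - q.[x0] * w)); first ring.
  by rewrite Ep Em addr0.
have /factor_theorem[p1 pE] : root p x0 by rewrite /root p0.
(* At a branch point the two points coincide and the values at them give only [p(x0) = 0]. As
   [X - x0] is [Y ^ 2] times a unit there, dividing the relation by [Y] shows that [fp q] is [Y]
   times a regular function. *)
have q0 : q.[x0] = 0.
  have [w0|w0] := eqVneq w 0; last first.
    by apply: (mulIf w0); rewrite mul0r -Ep p0 add0r.
  have [wu [cu [_ vwu rE]]] := branch_X ow w0.
  have [c vc] := reg _ _ ow.
  have : fp q = Y * (wu * (g * fp d1 - fp p1)).
    apply: (mulIf Y_neq0); move: e; rewrite dE pE !rmorphM !fp_r rE.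
    move=> e; transitivity (g * (fp d1 * (Y ^+ 2 * wu)) - fp p1 * (Y ^+ 2 * wu)).
      by rewrite e; ring.
    by ring.
  move=> qE; have vq := val_poly ow q; rewrite qE in vq.
  have ev := affine_ev_eq0 ow.
  have v2 := has_valueM vwu (has_valueB ev (has_valueM vc (val_poly ow d1)) (val_poly ow p1)).
  have := has_value_inj ev vq (has_valueM (val_Y ow) v2).
  by rewrite w0 mul0r.
have /factor_theorem[q1 qE] : root q x0 by rewrite /root q0.
have d10 : d1 != 0 by apply: contraNneq d0 => d10; rewrite dE d10 mul0r.
apply: (IH p1 q1 d1) => //.
  by move: sd; rewrite dE size_Mmonic ?monicXsubC // size_XsubC addn2.
apply: (mulIf (r_neq0 x0)); move: e; rewrite dE pE qE !rmorphM !fp_r => e.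
by rewrite -mulrA e; ring.
Qed.

(** Transfers the order of a norm from one point above [x = 0] to the polynomial itself, keeping the
    value of the cofactor. *)
Lemma factor_Xn (q0 : K) (N : {poly K}) v c n : onC 0 q0 ->
  fp N = X ^+ n * v -> val_at 0 q0 v c ->
  exists2 N' : {poly K}, N = 'X^n * N' & N'.[0] = c.
Proof.
move=> oq; have ev := affine_ev_eq0 oq.
elim: n N => [|n IH] N NE vc.
  exists N; rewrite ?expr0 ?mul1r //.
  by move: NE; rewrite expr0 mul1r => NE; apply: has_value_inj (val_poly oq N) _; rewrite ?NE.
have vX : val_at 0 q0 X 0 by have := val_poly oq 'X; rewrite hornerX.
have /factor_theorem[N1 N1E] : root N 0.
  rewrite /root; apply/eqP; apply: has_value_inj (val_poly oq N) _ => //; rewrite NE exprS.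
  by have := has_valueM vX (has_valueM (has_valueX n vX) vc); rewrite mul0r mulrA.
have [|N' N'E N'0] := IH N1 _ vc.
  apply: (mulfI X_neq0); rewrite mulrA -exprS -NE N1E subr0.
  by rewrite rmorphM mulrC.
by exists N' => //; rewrite N1E N'E subr0 mulrC mulrA -exprS.
Qed.

Lemma norm_at (p q : {poly K}) x0 :
  (p ^+ 2 - q ^+ 2 * cub).[x0] = p.[x0] ^+ 2 - q.[x0] ^+ 2 * cub.[x0].
Proof. by rewrite hornerD hornerN [X in _ - X]hornerM !horner_exp. Qed.

Lemma fp_norm (p q : {poly K}) :
  fp (p ^+ 2 - q ^+ 2 * cub) = (fp p + fp q * Y) * (fp p - fp q * Y).
Proof. by rewrite rmorphB [X in _ - X]rmorphM /= -Y2 !rmorphXn /=; ring. Qed.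

(** * Functions with divisor n Q_0 - n Q_l and the polynomial identity *)

Section Order.
Variables (q0 : K) (n : nat).
Hypothesis (n0 : (0 < n)%N) (q0E : q0 ^+ 2 = a * b * l).

Let oq0 : onC 0 q0. Proof. by rewrite !subr0. Qed.
Let ol : onC l 0. Proof. by rewrite subrr mulr0 expr0n. Qed.
Let q0_neq0 : q0 != 0.
Proof. by rewrite -sqrf_eq0 q0E !mulf_neq0. Qed.
Let q0N : - q0 != q0.
Proof.
by rewrite -subr_eq0 -opprD oppr_eq0 -mulr2n -mulr_natl mulf_neq0.
Qed.

Definition expected_order (x0 y0 : K) : int :=
  n%:Z *+ ((x0, y0) == (0, q0)) - n%:Z *+ ((x0, y0) == (l, 0)).

(** The power [(l - X) ^ e] has order [2 e] at [(l, 0)]: it is the least one that clears a pole of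
    order [n] there, and it leaves a zero of order [odd n]. *)
Let e := uphalf n.
Let e2 : (e.*2 = n + odd n)%N.
Proof. by rewrite /e; move: n; clear; lia. Qed.

(** Once its pole is cleared, the function becomes [g = p + q Y]. The norm [p ^ 2 - q ^ 2 cub]
    vanishes only at 0, to order [n], and at [l] when [n] is odd; after division by these factors a
    polynomial without roots remains, which is a constant. *)
Lemma cayley_of_order h : h != 0 ->
    (forall x0 y0, onC x0 y0 ->
      has_order k (X - k x0) (Y - k y0) h (expected_order x0 y0)) ->
  cayley a b l n.
Proof.
move=> h0 ho; pose g := h * fp ((l%:P - 'X) ^+ e).
have gen x0 y0 : onC x0 y0 -> (x0, y0) != (0, q0) -> x0 != l ->
    exists2 c, c != 0 & val_at x0 y0 g c.
  move=> o /negPf n1 /negPf n2; have := ho _ _ o.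
  rewrite /expected_order n1 xpair_eqE n2 /= subrr => -[t [u [_ lu hE]]].
  have /(local_unitP (affine_ev_eq0 o)) [c c0 vc] := lu.
  exists (c * (l - x0) ^+ e); first by rewrite mulf_neq0 ?expf_neq0 // subr_eq0 eq_sym n2.
  rewrite /g hE expr0z mulr1; apply: has_valueM => //.
  by have := val_poly o ((l%:P - 'X) ^+ e); rewrite horner_exp !hornerE.
have [u [c [c0 vu hE]]] : exists u c, [/\ c != 0, val_at 0 q0 u c & h = u * X ^+ n].
  have := ho _ _ oq0; rewrite /expected_order eqxx xpair_eqE eq_sym (negPf l0) /= subr0.
  have eX : X - k 0 = X by rewrite rmorph0 subr0.
  move=> /(has_order_uniformizer (affine_ev_eq0 oq0) (r_neq0 0) (uniformizer_X oq0 q0_neq0)).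
  by rewrite eX.
have [w [cw [cw0 vw rE]]] := branch_X ol (erefl 0).
have [v [d [d0 vd gE]]] : exists v d,
    [/\ d != 0, val_at l 0 v d & g = v * Y ^+ odd n].
  have := ho _ _ ol; rewrite /expected_order eqxx xpair_eqE (negPf l0) /= sub0r.
  move=> /(has_order_uniformizer (affine_ev_eq0 ol) Y_neq0 (uniformizer_Y ol (erefl 0))).
  move=> [u1 [c1 [c10 vu1 hE1]]]; exists (u1 * (- w) ^+ e), (c1 * (- cw) ^+ e).
  rewrite mulf_neq0 ?expf_neq0 ?oppr_eq0 //; split=> //.
    by apply: has_valueM => //; apply: has_valueX; apply: has_valueN.
  rewrite /g hE1 rmorphXn rmorphB /= -kE -opprB rE -mulrN exprMn -exprM mul2n e2.
  rewrite exprD -exprnN; have := expf_neq0 n Y_neq0.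
  by move: (Y ^+ n) (Y ^+ odd n) ((- w) ^+ e) => y1 y2 y3 y10; field.
have [p [q pqE]] : exists p q, g = fp p + fp q * Y.
  apply: polynomial_of_regular => x0 y0 o.
  have [xl|xl] := eqVneq x0 l.
    have y00 : y0 = 0.
      by apply/eqP; rewrite -sqrf_eq0 o xl subrr mulr0.
    rewrite xl y00 gE; exists (d * 0 ^+ odd n); apply: has_valueM => //.
    by apply: has_valueX; exact: val_Y.
  have [[-> ->]|xy] := eqVneq (x0, y0) (0, q0).
    rewrite /g hE; eexists.
    by apply: has_valueM (has_valueM vu (has_valueX n (val_poly oq0 'X))) (val_poly oq0 _).
  by have [c1 _ vc1] := gen _ _ o xy xl; exists c1.
have gval x0 y0 c1 : onC x0 y0 -> val_at x0 y0 g c1 -> p.[x0] + q.[x0] * y0 = c1.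
  by move=> o; rewrite pqE => /(has_value_inj (affine_ev_eq0 o) (val_polyY o p q)).
pose N := p ^+ 2 - q ^+ 2 * cub.
have NE : fp N = g * (fp p - fp q * Y).
  by rewrite pqE /N fp_norm.
have NX : forall x0, N.[x0] = _ := norm_at p q.
have oN x0 y0 : onC x0 y0 -> onC x0 (- y0) by rewrite sqrrN.
have Nx0 x0 : x0 != 0 -> x0 != l -> N.[x0] != 0.
  move=> x00 xl; have [y0 o] := closed_sqrt ((a - x0) * (b - x0) * (l - x0)).
  have xy z : (x0, z) != (0, q0) by rewrite xpair_eqE (negPf x00).
  have [c1 c10 /(gval _ _ _ o) v1] := gen _ _ o (xy _) xl.
  have [c2 c20 /(gval _ _ _ (oN _ _ o)) v2] := gen _ _ (oN _ _ o) (xy _) xl.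
  have -> : N.[x0] = c1 * c2; last by rewrite mulf_neq0.
  by rewrite -v1 -v2 NX cub_at -o; ring.
have g00 : p.[0] + q.[0] * q0 = 0.
  apply: gval oq0 _; rewrite /g hE.
  have := has_valueM (has_valueM vu (has_valueX n (val_poly oq0 'X))) (val_poly oq0 ((l%:P - 'X) ^+ e)).
  by rewrite hornerX expr0n eqn0Ngt n0 mulr0 mul0r.
have g0N : p.[0] - q.[0] * q0 != 0.
  have xy : ((0, - q0) : K * K) != (0, q0) by rewrite xpair_eqE eqxx.
  have l0' : 0 != l by rewrite eq_sym.
  have [c1 c10 /(gval _ _ _ (oN _ _ oq0)) v1] := gen _ _ (oN _ _ oq0) xy l0'.
  by rewrite -mulrN v1.
have p0 : p.[0] != 0.
  apply: contraNneq g0N => p00; move: g00; rewrite p00 add0r => ->.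
  by rewrite subrr.
(* This is the norm divided by [X ^ n]. It is a unit at [(0, q0)] because the conjugate of [g] there
   is the value of [g] at [(0, - q0)], outside the divisor. *)
have vN : val_at 0 q0 (u * fp ((l%:P - 'X) ^+ e) * (fp p - fp q * Y))
    (c * l ^+ e * (p.[0] - q.[0] * q0)).
  apply: has_valueM.
    apply: has_valueM => //; have := val_poly oq0 ((l%:P - 'X) ^+ e).
    by rewrite horner_exp !hornerE subr0.
  apply: has_valueB (val_poly oq0 p) _; first exact: affine_ev_eq0.
  by apply: has_valueM (val_poly oq0 q) (val_Y oq0).
have cN0 : c * l ^+ e * (p.[0] - q.[0] * q0) != 0.
  by rewrite !mulf_neq0 // expf_neq0.
have gl : p.[l] = d * 0 ^+ odd n.
  have := gval _ _ (d * 0 ^+ odd n) ol; rewrite mulr0 addr0; apply.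
  by rewrite gE; apply: has_valueM => //; apply: has_valueX; exact: val_Y.
have const (N' : {poly K}) : (forall x0, N'.[x0] != 0) -> exists2 c', c' != 0 & N' = c'%:P.
  move=> nr; apply/size_poly1P; apply: contraT => /closed_rootP[x0].
  by rewrite /root (negPf (nr x0)).
have [on|on] := boolP (odd n); last first.
  have [|N' N'E N'0] := factor_Xn (N := N) oq0 _ vN (n := n).
    by rewrite NE /g hE; ring.
  have [x0|c' c'0 c'E] := const N'.
    have [->|x00] := eqVneq x0 0; first by rewrite N'0.
    have : N.[x0] != 0.
      have [->|xl] := eqVneq x0 l; last exact: Nx0.
      rewrite NX cub_at subrr !mulr0 subr0 gl.
      by rewrite (negPf on) mulr1 expf_neq0.
    by rewrite N'E hornerM mulf_eq0 negb_or => /andP[].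
  exists p, q, c'; split=> //; rewrite (negPf on) -cubE -/N N'E c'E.
  by rewrite mulrC.
(* For [n] odd, [g] keeps a simple zero at [(l, 0)], so [l - x] divides [p] and hence the norm. *)
have /factor_theorem[A' A'E] : root p l by rewrite /root gl on mulr0.
pose A := - A'; have pE : p = (l%:P - 'X) * A.
  by rewrite A'E /A; ring.
pose N1 := (l%:P - 'X) * A ^+ 2 - q ^+ 2 * ((a%:P - 'X) * (b%:P - 'X)).
have NN1 : N = (l%:P - 'X) * N1 by rewrite /N /N1 pE cubE; ring.
have lX0 : fp (l%:P - 'X) != 0.
  by rewrite fp_eq0 -oppr_eq0 opprB polyXsubC_eq0.
have vl : val_at 0 q0 (fp (l%:P - 'X)) l.
  by have := val_poly oq0 (l%:P - 'X); rewrite !hornerE subr0.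
have vN1 := has_valueM vN (has_valueV l0 vl).
have [|N' N'E N'0] := factor_Xn (N := N1) oq0 _ vN1 (n := n).
  apply: (mulfI lX0); rewrite -rmorphM -NN1 NE /g hE.
  by move: lX0; move: (fp (l%:P - 'X)) => z z0; field.
(* Dividing [g] by [Y] near [(l, 0)] leaves [q] plus a multiple of [Y], so [q(l)] is the leading
   value [d] of [g]. Being nonzero, it prevents [N1] from vanishing at [l]. *)
have ql : q.[l] = d.
  have ev := affine_ev_eq0 ol.
  have vq := val_poly ol q.
  have qE : fp q = v + fp A * w * Y.
    apply: (mulIf Y_neq0); apply: (addrI (fp p)); rewrite -pqE gE on expr1.
    by rewrite pE rmorphM rmorphB /= -kE -opprB rE; ring.
  rewrite qE in vq.
  have := has_value_inj ev vq (has_valueD ev vd (has_valueM (has_valueM (val_poly ol A) vw) (val_Y ol))).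
  by rewrite mulr0 addr0.
have [x0|c' c'0 c'E] := const N'.
  have [->|x00] := eqVneq x0 0.
    by rewrite N'0 mulf_neq0 // invr_eq0.
  have : N1.[x0] != 0.
    have [->|xl] := eqVneq x0 l.
      have -> : N1.[l] = - (d ^+ 2 * ((a - l) * (b - l))).
        rewrite -ql /N1 hornerD hornerN [X in X - _]hornerM [X in _ - X]hornerM.
        rewrite !horner_exp [((_ - _) * _).[l]]hornerM.
        by rewrite !(hornerD, hornerN, hornerC, hornerX); ring.
      by rewrite oppr_eq0 !mulf_neq0 ?expf_neq0 ?subr_eq0.
    by have := Nx0 _ x00 xl; rewrite NN1 hornerM mulf_eq0 negb_or => /andP[].
  by rewrite N'E hornerM mulf_eq0 negb_or => /andP[].
exists A, q, c'; rewrite on; split=> //.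
  by apply: contraNneq p0 => A0; rewrite pE hornerM A0 mulr0.
by rewrite -/N1 N'E c'E mulrC.
Qed.

(** The sign of [B] is chosen so that [p + q Y], rather than its conjugate, vanishes at [(0, q0)].
    The degrees follow because the two terms of the identity have degrees of opposite parity: their
    leading terms cannot cancel, and both degrees are at most [n]. *)
Lemma cayley_normal_form : cayley a b l n ->
  exists p q c, [/\ c != 0, p.[0] != 0, p.[0] + q.[0] * q0 = 0,
    p ^+ 2 - q ^+ 2 * cub = c%:P * 'X^n * (l%:P - 'X) ^+ odd n &
    [/\ size p = e.+1, (size q < e)%N &
     if odd n then q.[l] != 0 /\ exists A, p = (l%:P - 'X) * A else p.[l] != 0]].
Proof.
have szB (u v : {poly K}) : size u != size v -> size (u - v) = maxn (size u) (size v).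
  have [lt _|lt _|-> /eqP //] := ltngtP (size u) (size v).
    by rewrite addrC size_polyDl size_polyN // (maxn_idPr (ltnW lt)).
  by rewrite size_polyDl ?size_polyN // (maxn_idPl (ltnW lt)).
have slX (d : K) : size (d%:P - 'X) = 2 by rewrite -size_polyN opprB size_XsubC.
have lX0 (d : K) : d%:P - 'X != 0 :> {poly K} by rewrite -size_poly_eq0 slX.
move=> [A [B [c [c0 A0 E]]]].
have A00 : A != 0 by apply: contraNneq A0 => ->; rewrite horner0.
pose p := if odd n then (l%:P - 'X) * A else A.
have NE : p ^+ 2 - B ^+ 2 * cub = c%:P * 'X^n * (l%:P - 'X) ^+ odd n.
  by rewrite /p cubE -E; case: odd; ring.
have p0 : p.[0] != 0.
  by rewrite /p; case: odd => //; rewrite !hornerE mulf_neq0 // subr0.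
have : (p.[0] - B.[0] * q0) * (p.[0] + B.[0] * q0) = 0.
  transitivity ((p ^+ 2 - B ^+ 2 * cub).[0]).
    by rewrite norm_at cub_at !subr0 -q0E; ring.
  rewrite NE !hornerM hornerXn expr0n eqn0Ngt n0 /=.
  by rewrite mulr0 mul0r.
have szc : size (c%:P * 'X^n) = n.+1.
  by rewrite mul_polyC size_scale // size_polyXn.
have sA : size (A ^+ 2) = (size A).*2.-1 by rewrite expr2 size_mul // addnn.
have [sp sB] : size p = e.+1 /\ (size B < e)%N.
  have sA0 : (0 < size A)%N by rewrite size_poly_gt0.
  have A20 : A ^+ 2 != 0 by rewrite expf_neq0.
  have s1 : size ((l%:P - 'X) * A ^+ 2) = (size A).*2.
    by rewrite (size_mul (lX0 l) A20) slX sA; move: sA0; clear; lia.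
  have s3 : size ((l%:P - 'X) * A) = (size A).+1 by rewrite (size_mul (lX0 l) A00) slX.
  have := szc; rewrite -E /p; have [B0|B0] := eqVneq B 0.
    rewrite B0 expr0n !mul0r !subr0 size_poly0.
    case: (odd n) (odd_double_half n) => nE.
      by rewrite s1 s3; move: n0 sA0 nE; rewrite /e; clear; lia.
    by rewrite sA; move: n0 sA0 nE; rewrite /e; move: (size A) => m; clear; lia.
  have sB0 : (0 < size B)%N by rewrite size_poly_gt0.
  have sB : size (B ^+ 2) = (size B).*2.-1 by rewrite expr2 size_mul // addnn.
  have B20 : B ^+ 2 != 0 by rewrite expf_neq0.
  have sab : size ((a%:P - 'X) * (b%:P - 'X)) = 3 by rewrite size_mul // !slX.
  have ab0 : (a%:P - 'X) * (b%:P - 'X) != 0 by rewrite mulf_neq0.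
  case: (odd n) (odd_double_half n) => nE.
    have s2 : size (B ^+ 2 * ((a%:P - 'X) * (b%:P - 'X))) = (size B).*2.+1.
      by rewrite (size_mul B20 ab0) sab sB; move: sB0; clear; lia.
    rewrite szB s1 s2 ?s3; last by move: (size A) (size B) => m m'; clear; lia.
    by move: n0 nE; rewrite /e; move: (size A) (size B) => m m'; clear; lia.
  have s2 : size (B ^+ 2 * ((a%:P - 'X) * (b%:P - 'X) * (l%:P - 'X))) = (size B).*2.+2.
    by rewrite -cubE (size_mul B20 cub_neq0) size_cub sB; move: sB0; clear; lia.
  rewrite szB sA s2; last by move: sA0; move: (size A) (size B) => m m'; clear; lia.
  by move: n0 nE sA0; rewrite /e; move: (size A) (size B) => m m'; clear; lia.
have pl : if odd n then B.[l] != 0 /\ exists A, p = (l%:P - 'X) * A else p.[l] != 0.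
  rewrite /p; move: E; case: (odd n) => E.
    split; last by exists A.
    have := congr1 (fun u => u.[l]) E; rewrite !hornerE subrr => El.
    apply: contra_eq_neq El => ->; rewrite eq_sym.
    by rewrite expr0n /= !mul0r subr0 mulf_neq0 ?expf_neq0.
  have := congr1 (fun u => u.[l]) E; rewrite !hornerE subrr => El.
  apply: contra_eq_neq El => ->; rewrite eq_sym.
  by rewrite expr0n /= !(mul0r, mulr0) subr0 mulf_neq0 ?expf_neq0.
move=> /eqP; rewrite mulf_eq0 => /orP[] /eqP pB; last first.
  by exists p, B, c; split.
exists p, (- B), c; rewrite sqrrN hornerN mulNr pB size_polyN; split=> //; split=> //.
move: pl; case: (odd n) => // -[Bl Ap]; split=> //.
by rewrite hornerN oppr_eq0.
Qed.

(** The function is [(p + q Y) / (l - X) ^ e]. Its order at [(0, q0)] is that of the norm, since the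
    conjugate does not vanish there; at infinity the degree bounds leave the leading coefficient of
    [p], up to sign, as its value. *)
Lemma order_of_cayley : cayley a b l n ->
  exists h, [/\ h != 0,
    forall x0 y0, onC x0 y0 ->
      has_order k (X - k x0) (Y - k y0) h (expected_order x0 y0) &
    has_order k (X / Y) Y^-1 h 0].
Proof.
move=> /cayley_normal_form[p [q [c [c0 p0 pq NE [sp sq pl]]]]].
pose h := (fp p + fp q * Y) / fp (l%:P - 'X) ^+ e.
have X0 := X_neq0; have Y0 := Y_neq0.
have lX0 : fp (l%:P - 'X) != 0.
  by rewrite fp_eq0 -oppr_eq0 opprB polyXsubC_eq0.
have vinf : has_value k (X / Y) Y^-1 h (p`_e / (-1) ^+ e).
  have vl : has_value k (X / Y) Y^-1 (fp (l%:P - 'X) / X ^+ 1) (-1).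
    have -> : -1 = (l%:P - 'X)`_1 by rewrite coefB coefC coefX sub0r.
    by apply: val_poly_infinity; rewrite -size_polyN opprB size_XsubC.
  have -> : h = (fp p / X ^+ e + fp q * Y / X ^+ e) / (fp (l%:P - 'X) / X ^+ 1) ^+ e.
    rewrite /h expr1 exprMn exprVn; have := expf_neq0 e X0; have := expf_neq0 e lX0.
    move: (X ^+ e) (fp (l%:P - 'X) ^+ e) => u v u0 v0.
    by field; rewrite u0 v0.
  have v1 : (-1 : K) ^+ e != 0 by rewrite expf_neq0 // oppr_eq0 oner_neq0.
  apply: has_valueM; last by apply: has_valueV => //; exact: has_valueX.
  rewrite -[p`_e]addr0; apply: has_valueD; first exact: infinity_ev_eq0.
    by apply: val_poly_infinity; rewrite sp.
  exact: val_polyY_infinity.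
have hinf0 : p`_e / (-1) ^+ e != 0.
  rewrite mulf_neq0 ?invr_eq0 ?expf_neq0 ?oppr_eq0 ?oner_neq0 //.
  have -> : e = (size p).-1 by rewrite sp.
  rewrite -lead_coefE lead_coef_eq0.
  by apply: contraNneq p0 => ->; rewrite horner0.
have h0 : h != 0.
  exact: (has_value_neq0 infinity_ev_eq0 hinf0 vinf).
exists h; split=> //; last first.
  by apply: (has_orderI infinity_ev_eq0 uniformizer_infinity hinf0 vinf); rewrite expr0z mulr1.
have vden x0 y0 (o : onC x0 y0) : val_at x0 y0 (fp (l%:P - 'X) ^+ e) ((l - x0) ^+ e).
  apply: has_valueX; have := val_poly o (l%:P - 'X).
  by rewrite !hornerE.
move=> x0 y0 o.
have ev := affine_ev_eq0 o.
have [xl|xl] := eqVneq x0 l.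
  have y00 : y0 = 0 by apply/eqP; rewrite -sqrf_eq0 o xl subrr mulr0.
  rewrite xl y00 in ev o *.
  rewrite /expected_order eqxx xpair_eqE (negPf l0) /= sub0r.
  have [w [cw [cw0 vw rE]]] := branch_X ol (erefl 0).
  have lE : fp (l%:P - 'X) = Y ^+ 2 * - w.
    by rewrite rmorphB /= -kE -opprB rE mulrN.
  have [v [d [d0 vd vE]]] : exists v d, [/\ d != 0, val_at l 0 v d &
      fp p + fp q * Y = v * Y ^+ odd n].
    move: pl; case: (odd n) => [[ql [A pE]]|pl].
      exists (fp q + fp A * (- w) * Y), (q.[l] + A.[l] * (- cw) * 0).
      rewrite mulr0 addr0; split=> //; last by rewrite pE rmorphM lE; ring.
      have := has_valueD ev (val_poly ol q) (has_valueM (has_valueM (val_poly ol A)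
        (has_valueN vw)) (val_Y ol)).
      by rewrite mulr0 addr0.
    exists (fp p + fp q * Y), p.[l]; split=> //; last by rewrite expr0 mulr1.
    by have := val_polyY ol p q; rewrite mulr0 addr0.
  have w0 : w != 0 by apply: contraNneq (r_neq0 l) => w0; rewrite rE w0 mulr0.
  have cwe : (- cw) ^+ e != 0 by rewrite expf_neq0 // oppr_eq0.
  apply: (has_orderI ev (uniformizer_Y ol (erefl 0)) _
    (has_valueM vd (has_valueV cwe (has_valueX e (has_valueN vw))))).
    by rewrite mulf_neq0 // invr_eq0.
  rewrite /h vE lE exprMn -exprM mul2n e2 exprD -exprnN.
  have := expf_neq0 n Y0; have := expf_neq0 (odd n) Y0.
  have : (- w) ^+ e != 0 by rewrite expf_neq0 // oppr_eq0.
  move: (Y ^+ n) (Y ^+ odd n) ((- w) ^+ e) => y1 y2 y3 y10 y20 y30.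
  by field; rewrite y10 y20 y30.
have lx0 : (l - x0) ^+ e != 0 by rewrite expf_neq0 // subr_eq0 eq_sym.
have g0N : p.[0] - q.[0] * q0 != 0.
  apply: contra_neq p0 => e1; apply: (mulfI two); rewrite mulr0.
  transitivity ((p.[0] + q.[0] * q0) + (p.[0] - q.[0] * q0)); first ring.
  by rewrite e1 pq addr0.
have [xy|xy] := eqVneq (x0, y0) (0, q0).
  rewrite /expected_order xy eqxx xpair_eqE eq_sym (negPf l0) /= subr0.
  case: xy => xE yE; rewrite xE yE in ev o xl lx0 *.
  have vm : val_at 0 q0 (fp p - fp q * Y) (p.[0] - q.[0] * q0).
    apply: has_valueB (val_poly oq0 p) _ => //.
    exact: (has_valueM (val_poly oq0 q) (val_Y oq0)).
  have m0 : fp p - fp q * Y != 0.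
    exact: (has_value_neq0 ev g0N vm).
  have vlo := has_valueX (odd n) (val_poly oq0 (l%:P - 'X)).
  have vu := has_valueM (has_valueM (has_valueM (has_valueC k (X - k 0) (Y - k q0) c) vlo)
    (has_valueV g0N vm)) (has_valueV lx0 (vden _ _ oq0)).
  have uX : uniformizer k (X - k 0) (Y - k q0) X.
    by have := uniformizer_X oq0 q0_neq0; rewrite {2}rmorph0 subr0.
  apply: (has_orderI ev uX _ vu).
    by rewrite !mulf_neq0 ?invr_eq0 // expf_neq0 // !hornerE subr0.
  have pqN : fp p + fp q * Y = k c * X ^+ n * fp (l%:P - 'X) ^+ odd n / (fp p - fp q * Y).
    apply: (mulIf m0); rewrite divfK //.
    by rewrite -fp_norm NE !rmorphM !rmorphXn /= kE.
  rewrite mulr1n -exprnP /h pqN; have := expf_neq0 e lX0.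
  move: (fp (l%:P - 'X) ^+ e) (X ^+ n) (fp (l%:P - 'X) ^+ odd n) => u1 u2 u3 u10.
  by field; rewrite m0 u10.
rewrite /expected_order (negPf xy) xpair_eqE (negPf xl) /= subr0.
have v0 : p.[x0] + q.[x0] * y0 != 0.
  have Nx : (p.[x0] + q.[x0] * y0) * (p.[x0] - q.[x0] * y0) =
      c * x0 ^+ n * (l - x0) ^+ odd n.
    transitivity ((p ^+ 2 - q ^+ 2 * cub).[x0]).
      by rewrite norm_at cub_at -o; ring.
    by rewrite NE !hornerM hornerXn horner_exp !hornerE.
  have [x00|x00] := eqVneq x0 0.
    move: o xy; rewrite x00 !subr0 -q0E => /eqP; rewrite eqf_sqr xpair_eqE eqxx /=.
    move=> /orP[/eqP -> /eqP //|/eqP -> _]; by rewrite mulrN.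
  have : c * x0 ^+ n * (l - x0) ^+ odd n != 0.
    by rewrite !mulf_neq0 ?expf_neq0 // subr_eq0 eq_sym.
  by rewrite -Nx mulf_eq0 negb_or => /andP[].
have vh : val_at x0 y0 h ((p.[x0] + q.[x0] * y0) / (l - x0) ^+ e).
  by apply: has_valueM (val_polyY o p q) (has_valueV lx0 (vden _ _ o)).
have vh0 : (p.[x0] + q.[x0] * y0) / (l - x0) ^+ e != 0 by rewrite mulf_neq0 ?invr_eq0.
have h1 t : h = h * t ^ (0 : int) by rewrite expr0z mulr1.
have [y00|y00] := eqVneq y0 0.
  exact: (has_orderI ev (uniformizer_Y o y00) vh0 vh (h1 _)).
exact: (has_orderI ev (uniformizer_X o y00) vh0 vh (h1 _)).
Qed.

End Order.

End Curve.

(** * The function field [funfield] *)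

Lemma polyC_add_scaleX_eq0 (A : nzRingType) (u v : A) :
  u%:P + v *: 'X = 0 -> u = 0 /\ v = 0.
Proof.
move=> /polyP e; have := e 0; have := e 1.
by rewrite !coefD !coefC !coefZ !coefX /= mulr0 addr0 mulr1 add0r.
Qed.

Lemma addr_eq0_mul (A : pzRingType) (u v w : A) : u = 0 -> v = 0 -> u + v * w = 0.
Proof. by move=> -> ->; rewrite mul0r addr0. Qed.

Lemma common_denominator (A : comNzRingType) (u v w d e p q : A) :
  u * d = p -> v * e = q -> (u + v * w) * (d * e) = p * e + q * d * w.
Proof. by move=> <- <-; ring. Qed.

Section FunctionField.
Variables (K : closedFieldType) (a b l : K).
Local Notation F := (funfield a b l).
Local Notation y := (fun_y a b l).
Local Notation x := (fun_x a b l).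
Local Notation cub := (cubic a b l).
Local Notation W := (weierstrass a b l).

Definition fun_poly (p : {poly K}) : F := qpolyC W (tofrac p).

Lemma fun_poly_zmod : zmod_morphism fun_poly.
Proof. by move=> p q; rewrite /fun_poly raddfB /= [LHS]raddfB. Qed.
Lemma fun_poly_monoid : monoid_morphism fun_poly.
Proof.
split=> [|p q]; first by rewrite /fun_poly rmorph1.
by rewrite /fun_poly rmorphM /= [LHS]qpolyCM.
Qed.
HB.instance Definition _ :=
  GRing.isZmodMorphism.Build {poly K} F fun_poly fun_poly_zmod.
HB.instance Definition _ :=
  GRing.isMonoidMorphism.Build {poly K} F fun_poly fun_poly_monoid.

Lemma fun_constE c : fun_const a b l c = fun_poly c%:P.
Proof. by []. Qed.
Lemma fun_xE : x = fun_poly 'X.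
Proof. by []. Qed.

Lemma fun_const_zmod : zmod_morphism (@fun_const K a b l).
Proof. by move=> p q; rewrite !fun_constE !raddfB. Qed.
Lemma fun_const_monoid : monoid_morphism (@fun_const K a b l).
Proof.
by split=> [|p q]; rewrite !fun_constE ?rmorph1 // !rmorphM.
Qed.
HB.instance Definition _ :=
  GRing.isZmodMorphism.Build K F (@fun_const K a b l) fun_const_zmod.
HB.instance Definition _ :=
  GRing.isMonoidMorphism.Build K F (@fun_const K a b l) fun_const_monoid.

Lemma weierstrass_monic : W \is monic.
Proof. by case: (weierstrass_irr a b l). Qed.
Lemma size_weierstrass : size W = 3.
Proof. exact: size_XnsubC. Qed.

Lemma mk_monicW : mk_monic W = W.
Proof. by rewrite /mk_monic size_weierstrass weierstrass_monic. Qed.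

Lemma fun_yE : polyn y = 'X.
Proof. by rewrite /fun_y qpolyXE ?size_weierstrass ?weierstrass_monic. Qed.

Lemma qpolyXC (r : {fraction {poly K}}) : polyn ((qpolyC W r : F) * y) = r *: 'X.
Proof.
rewrite [polyn _]poly_of_qpolyM fun_yE qpolyCE mk_monicW mul_polyC.
rewrite Pdiv.CommonRing.rmodp_small // size_weierstrass (leq_ltn_trans (size_scale_leq _ _)) //.
by rewrite size_polyX.
Qed.

Lemma fun_y2 : y ^+ 2 = fun_poly cub.
Proof.
rewrite expr2; apply: val_inj; rewrite [LHS]poly_of_qpolyM fun_yE.
transitivity (tofrac cub)%:P => //; rewrite mk_monicW.
have -> : ('X * 'X : {poly {fraction {poly K}}}) = 1 * W + (tofrac cub)%:P.
  by rewrite mul1r /weierstrass subrK expr2.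
rewrite Pdiv.RingMonic.rmodp_addl_mul_small ?weierstrass_monic // size_weierstrass.
by rewrite size_polyC; case: eqP.
Qed.

Lemma qpoly_decomp (h : F) :
  h = (qpolyC W (polyn h)`_0 : F) + (qpolyC W (polyn h)`_1 : F) * y.
Proof.
apply: val_inj; rewrite [RHS]poly_of_qpolyD qpolyXC qpolyCE.
have sh : (size (polyn h) <= 2)%N.
  by rewrite -ltnS (leq_trans (size_mk_monic h)) // mk_monicW size_weierstrass.
apply/polyP => i; rewrite coefD coefC coefZ coefX.
case: i => [|[|i]] /=; rewrite ?mulr0 ?addr0 ?mulr1 ?add0r //.
by rewrite nth_default // (leq_trans sh).
Qed.

Lemma fracP (r : {fraction {poly K}}) :
  exists p q : {poly K}, q != 0 /\ r * tofrac q = tofrac p.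
Proof.
elim/quotW: r => r; exists (frac r).1, (frac r).2; split.
  exact: denom_ratioP.
unlock tofrac; rewrite -[LHS]FracField.pi_mul; apply/eqmodP.
rewrite /= FracField.equivfE /FracField.mulf.
by rewrite !numden_Ratio ?mulf_neq0 ?oner_eq0 ?denom_ratioP // !mulr1 mulrC.
Qed.

Lemma fun_decomp (h : F) : exists p q d : {poly K},
  d != 0 /\ h * fun_poly d = fun_poly p + fun_poly q * y.
Proof.
have [p [d [d0 pd]]] := fracP (polyn h)`_0.
have [q [e [e0 qe]]] := fracP (polyn h)`_1.
exists (p * e), (q * d), (d * e); split; first by rewrite mulf_neq0.
rewrite [in LHS](qpoly_decomp h) !rmorphM /=.
apply: common_denominator; first by rewrite /fun_poly -pd [RHS]qpolyCM.
by rewrite /fun_poly -qe [RHS]qpolyCM.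
Qed.

Lemma fun_indep p q : fun_poly p + fun_poly q * y = 0 -> p = 0 /\ q = 0.
Proof.
move=> /(congr1 (@polyn _ _)); rewrite [LHS]poly_of_qpolyD qpolyXC.
by move=> /polyC_add_scaleX_eq0[/eqP + /eqP]; rewrite !tofrac_eq0 => /eqP -> /eqP ->.
Qed.

Lemma fun_poly_eq0 p : (fun_poly p == 0) = (p == 0).
Proof.
apply/eqP/eqP => [p0|->]; last exact: rmorph0.
by have [] := fun_indep (addr_eq0_mul y p0 (rmorph0 fun_poly)).
Qed.

End FunctionField.

(** * Linear equivalence as a polynomial identity *)

Section LinEquiv.
Variables (K : closedFieldType) (a b l : K) (n : nat).
Hypothesis two : (2%:R : K) != 0.
Hypotheses (ab : a != b) (al : a != l) (bl : b != l).
Hypotheses (a0 : a != 0) (b0 : b != 0) (l0 : l != 0).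
Hypothesis n0 : (0 < n)%N.
Variables Q0 Ql : curve a b l.
Hypotheses (hQ0 : abscissa Q0 = Some 0) (hQl : abscissa Ql = Some l).

Local Notation F := (funfield a b l).
Local Notation D := (point_div Q0 *+ n - point_div Ql *+ n : divisor a b l).

Lemma coeff_difference (P : curve a b l) :
  coeff P D = n%:Z *+ (P == Q0) - n%:Z *+ (P == Ql).
Proof.
rewrite coeffB !coeffMn !coeffU !mul1r [Q0 == P]eq_sym [Ql == P]eq_sym.
by rewrite ![_%:R *+ n]mulrnAC natz.
Qed.

Lemma eval2E (P : curve a b l) G :
  eval2 P G = local_eval (@fun_const K a b l) (chart P).1 (chart P).2 G.
Proof. reflexivity.
Qed.

Lemma regular_atE (P : curve a b l) h :
  regular_at P h <-> regular (@fun_const K a b l) (chart P).1 (chart P).2 h.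
Proof.
by split=> -[G [H [H0 hE]]]; exists G, H; split=> //; move: hE; rewrite !eval2E.
Qed.

Lemma unit_atE (P : curve a b l) h :
  unit_at P h <-> local_unit (@fun_const K a b l) (chart P).1 (chart P).2 h.
Proof.
split=> -[h0 r1 r2]; refine (And3 h0 _ _).
- exact: (regular_atE P h).1 r1.
- exact: (regular_atE P h^-1).1 r2.
- exact: (regular_atE P h).2 r1.
exact: (regular_atE P h^-1).2 r2.
Qed.

Lemma vanishes_atE (P : curve a b l) h :
  vanishes_at P h <-> in_max (@fun_const K a b l) (chart P).1 (chart P).2 h.
Proof.
split=> -[r nu]; refine (conj _ (fun u => nu _)).
- exact: (regular_atE P h).1 r.
- exact: (unit_atE P h).2 u.
- exact: (regular_atE P h).2 r.
exact: (unit_atE P h).1 u.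
Qed.

Lemma uniformizer_atE (P : curve a b l) t :
  uniformizer_at P t <-> uniformizer (@fun_const K a b l) (chart P).1 (chart P).2 t.
Proof.
split=> -[vt dt]; split.
- exact: (vanishes_atE P t).1 vt.
- move=> h vh; have [g rg hE] := dt h ((vanishes_atE P h).2 vh).
  exact: (ex_intro2 _ _ g ((regular_atE P g).1 rg) hE).
- exact: (vanishes_atE P t).2 vt.
move=> h vh; have [g rg hE] := dt h ((vanishes_atE P h).1 vh).
exact: (ex_intro2 _ _ g ((regular_atE P g).2 rg) hE).
Qed.

Lemma order_atE (P : curve a b l) h k : order_at P h k <->
  has_order (@fun_const K a b l) (chart P).1 (chart P).2 h k.
Proof.
split=> -[t [u [ut uu hE]]]; exists t, u.
- exact: (And3 ((uniformizer_atE P t).1 ut) ((unit_atE P u).1 uu) hE).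
exact: (And3 ((uniformizer_atE P t).2 ut) ((unit_atE P u).2 uu) hE).
Qed.

Lemma chart_affine (P : curve a b l) x0 y0 : val P = Some (x0, y0) ->
  chart P = (fun_x a b l - fun_const a b l x0, fun_y a b l - fun_const a b l y0).
Proof. by rewrite /chart => ->. Qed.

Lemma chart_infinity (P : curve a b l) : val P = None ->
  chart P = (fun_x a b l / fun_y a b l, (fun_y a b l)^-1).
Proof. by rewrite /chart => ->. Qed.

(** The abscissas determine [Ql] but leave two choices [(0, q0)] and [(0, - q0)] for [Q0]. The
    identity involves only squares, so it covers both. *)
Lemma lin_equiv_cayley :
  lin_equiv (point_div Q0 *+ n) (point_div Ql *+ n) <-> cayley a b l n.
Proof.
have [q0 [q0E vQ0]] : exists q0, q0 ^+ 2 = a * b * l /\ val Q0 = Some (0, q0).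
  move: (valP Q0) hQ0; rewrite /abscissa; case: (val Q0) => // -[x q0] /eqP + [xE].
  by rewrite xE !subr0 => e; exists q0.
have vQl : val Ql = Some (l, 0).
  move: (valP Ql) hQl; rewrite /abscissa; case: (val Ql) => // -[x y] /eqP + [xE].
  by rewrite xE subrr mulr0 => /eqP; rewrite sqrf_eq0 => /eqP ->.
have cE x0 y0 (P : curve a b l) : val P = Some (x0, y0) ->
    coeff P D = expected_order l q0 n x0 y0.
  move=> vP; rewrite coeff_difference /expected_order -!val_eqE vP vQ0 vQl.
  by [].
have oc := @cayley_of_order K a b l F (@fun_const K a b l) (@fun_poly K a b l)
  (fun_y a b l) (cubic a b l) erefl two ab al bl a0 b0 l0 (@fun_constE K a b l)
  (fun_y2 a b l) (@fun_decomp K a b l) (@fun_indep K a b l) q0 n n0 q0E.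
have co := @order_of_cayley K a b l F (@fun_const K a b l) (@fun_poly K a b l)
  (fun_y a b l) (cubic a b l) erefl two ab al bl a0 b0 l0 (@fun_constE K a b l)
  (fun_y2 a b l) (@fun_indep K a b l) q0 n n0 q0E.
split=> [[h h0 hD]|/co[h [h0 haff hinf]]].
  apply: (oc h h0) => x0 y0 /eqP o.
  have /order_atE := hD (exist _ (Some (x0, y0)) o).
  by rewrite (@cE x0 y0) // (@chart_affine _ x0 y0).
exists h; first exact: h0.
move=> P; apply/order_atE; case vP: (val P) => [[x0 y0]|].
  have o : y0 ^+ 2 = (a - x0) * (b - x0) * (l - x0).
    by apply/eqP; have := valP P; rewrite vP.
  rewrite (cE _ _ _ vP) (chart_affine vP); exact: (haff x0 y0 o).
rewrite coeff_difference -!val_eqE vP vQ0 vQl subrr (chart_infinity vP).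
exact: hinf.
Qed.

End LinEquiv.

(** * The Pell equation *)

Lemma horner_norm (R : comNzRingType) (p q r : {poly R}) x :
  (p ^+ 2 - q ^+ 2 * r).[x] = p.[x] ^+ 2 - q.[x] ^+ 2 * r.[x].
Proof. by rewrite hornerD hornerN [X in _ - X]hornerM !horner_exp. Qed.

Section Reciprocal.
Variable K : closedFieldType.
Implicit Types p q u v w : {poly K}.

Lemma poly_eq_nonzero p q : (forall x, x != 0 -> p.[x] = q.[x]) -> p = q.
Proof.
move=> pq; apply/eqP; rewrite -subr_eq0; apply: contraT => d0.
have /closed_nonrootP[x] : 'X * (p - q) != 0 by rewrite mulf_neq0 ?polyX_eq0.
rewrite /root hornerM hornerX mulf_eq0 negb_or hornerD hornerN => /andP[x0].
by rewrite pq // subrr eqxx.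
Qed.

Lemma size_sqr p : size (p ^+ 2) = (size p).*2.-1.
Proof.
have [->|p0] := eqVneq p 0; first by rewrite expr0n size_poly0.
by rewrite expr2 (size_mul p0 p0) addnn.
Qed.

Lemma horner_normM w p q r x :
  (w * p ^+ 2 - q ^+ 2 * r).[x] = w.[x] * p.[x] ^+ 2 - q.[x] ^+ 2 * r.[x].
Proof.
by rewrite hornerD hornerN [X in X - _]hornerM [X in _ - X]hornerM !horner_exp.
Qed.

Definition reciprocal m p : {poly K} := \poly_(i < m.+1) p`_(m - i).

Lemma horner_reciprocal m p x : (size p <= m.+1)%N -> x != 0 ->
  (reciprocal m p).[x] = x ^+ m * p.[x^-1].
Proof.
move=> sp x0; rewrite horner_poly (horner_coef_wide _ sp) mulr_sumr.
rewrite (reindex_inj rev_ord_inj) /=; apply: eq_bigr => i _.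
rewrite subSS (subKn (ltn_ord i : (i <= m)%N)) mulrCA; congr (_ * _).
rewrite exprVn; apply: (mulIf (expf_neq0 i x0)); rewrite -mulrA mulVf ?expf_neq0 //.
by rewrite mulr1 -exprD subnK // -ltnS.
Qed.

Lemma reciprocal_at0 m p : (reciprocal m p).[0] = p`_m.
Proof. by rewrite horner_coef0 coef_poly subn0. Qed.

Lemma size_reciprocal m p : p.[0] != 0 -> size (reciprocal m p) = m.+1.
Proof. by move=> p0; rewrite size_poly_eq // subnn -horner_coef0. Qed.

(** A polynomial of degree at most [m - j], reversed at length [m], is divisible by [x ^ j]; [q] is
    the quotient. *)
Lemma reciprocal_shift m j p : (size p + j <= m.+1)%N ->
  exists q : {poly K}, forall x, x != 0 -> x ^+ j * q.[x] = x ^+ m * p.[x^-1].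
Proof.
have [->|p0] := eqVneq p 0; first by exists 0 => x _; rewrite !horner0 !mulr0.
have : (0 < size p)%N by rewrite size_poly_gt0.
move=> sp sj; have jm : (j <= m)%N by move: sp sj; move: (size p) => i; clear; lia.
exists (reciprocal (m - j) p) => x x0; rewrite horner_reciprocal //.
  by rewrite mulrA -exprD subnKC.
by move: sj; move: (size p) => i; clear; lia.
Qed.

(** By coprimality the square of each linear factor of [w] divides one of [u] and [v] entirely.
    Removing it lowers the degree of [w], down to constants, which are squares in a closed field. *)
Lemma coprime_square u v w : w != 0 -> coprimep u v -> u * v = w ^+ 2 ->
  exists s, u = s ^+ 2.
Proof.
have [m] := ubnP (size w); elim: m u v w => // m IH u v w sw w0 cuv e.
have [/eqP/size_poly1P[c c0 wE]|/closed_rootP[x]] := eqVneq (size w) 1%N.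
  have u0 : u != 0 by apply: contraNneq w0 => u0; move/eqP: e; rewrite u0 mul0r eq_sym sqrf_eq0.
  have v0 : v != 0 by apply: contraNneq w0 => v0; move/eqP: e; rewrite v0 mulr0 eq_sym sqrf_eq0.
  have : size (u * v) = 1%N by rewrite e wE -rmorphXn size_polyC expf_neq0.
  have su : (0 < size u)%N by rewrite size_poly_gt0.
  have sv : (0 < size v)%N by rewrite size_poly_gt0.
  rewrite (size_mul u0 v0) => suv.
  have /eqP/size_poly1P[d d0 ->] : size u = 1%N.
    by move: su sv suv; move: (size u) (size v) => i j; clear; lia.
  by have [t <-] := closed_sqrt d; exists t%:P; rewrite rmorphXn.
move=> /factor_theorem[w' wE].
have w'0 : w' != 0 by apply: contraNneq w0 => w'0; rewrite wE w'0 mul0r.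
have sw' : (size w' < m)%N.
  by move: sw; rewrite wE size_Mmonic ?monicXsubC // size_XsubC addn2.
have X0 : ('X - x%:P) ^+ 2 != 0 by rewrite expf_neq0 // polyXsubC_eq0.
have dv : ('X - x%:P) ^+ 2 %| u * v by rewrite e wE exprMn dvdp_mulIr.
have [ux|ux] := boolP (root u x).
  have vx : ~~ root v x by rewrite /root; apply: coprimep_root cuv ux.
  move: dv; rewrite Gauss_dvdpl ?coprimep_expl // 1?coprimep_sym ?coprimep_XsubC // => /dvdpP[u' uE].
  have cu' : coprimep u' v by move: cuv; rewrite uE coprimepMl => /andP[].
  have [|s sE] := IH u' v w' sw' w'0 cu'.
    by apply: (mulIf X0); rewrite -exprMn -wE -e uE mulrAC.
  by exists (s * ('X - x%:P)); rewrite uE sE exprMn.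
move: dv; rewrite Gauss_dvdpr ?coprimep_expl // 1?coprimep_sym ?coprimep_XsubC // => /dvdpP[v' vE].
have cv' : coprimep u v' by move: cuv; rewrite vE coprimepMr => /andP[].
apply: (IH u v' w' sw' w'0 cv').
by apply: (mulIf X0); rewrite -exprMn -wE -e [in RHS]vE [RHS]mulrA.
Qed.

End Reciprocal.

(* In the variable [z = 1 / x], the curve becomes [w ^+ 2 = pell_poly]. *)
Definition pell_poly (K : fieldType) (a b l : K) : {poly K} :=
  'X * (a%:P * 'X - 1) * (b%:P * 'X - 1) * (l%:P * 'X - 1).

(** At each of the four roots of [pell_poly] the value of [s] is 1 or -1. Three of these signs are
    prescribed; the one at [1 / l] is left to the parity of [n]. *)
Definition pell (K : fieldType) (a b l : K) (n : nat) : Prop :=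
  exists s t : {poly K},
    [/\ s ^+ 2 - t ^+ 2 * pell_poly a b l = 1, size s = n.+1, s.[0] = 1,
        s.[a^-1] = 1 & s.[b^-1] = 1].

Section Pell.
Variables (K : closedFieldType) (a b l : K) (n : nat).
Hypothesis two : (2%:R : K) != 0.
Hypotheses (ab : a != b) (al : a != l) (bl : b != l).
Hypotheses (a0 : a != 0) (b0 : b != 0) (l0 : l != 0).
Hypothesis n0 : (0 < n)%N.

Local Notation P := (pell_poly a b l).
Local Notation P3 := ('X * (a%:P * 'X - 1) * (b%:P * 'X - 1) : {poly K}).

(** Multiplication by [d = 2 / c] makes the difference of [U] and [V] equal to 2, so that they
    become [s + 1] and [s - 1]. *)
Lemma pellI (U V g : {poly K}) (c : K) : c != 0 -> size U = n.+1 ->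
  U - V = c%:P -> U * V = g ^+ 2 * P -> V.[0] = 0 -> V.[a^-1] = 0 ->
  V.[b^-1] = 0 -> pell a b l n.
Proof.
move=> c0 sU UV UVg V0 Va Vb.
have UE : U = c%:P + V by rewrite -UV subrK.
pose d : K := 2 / c.
have dc : d%:P * c%:P = 2%:P :> {poly K} by rewrite -polyCM /d divfK.
have d0 : d != 0 by rewrite mulf_neq0 // invr_eq0.
have at1 x : V.[x] = 0 -> (d%:P * U - 1).[x] = 1.
  by move=> Vx; rewrite UE !hornerE Vx addr0 /d divfK //; ring.
exists (d%:P * U - 1), (d%:P * g); split; try exact: at1.
  have -> : (d%:P * g) ^+ 2 * P = d%:P ^+ 2 * (g ^+ 2 * P) by ring.
  rewrite -UVg UE.
  have -> : d%:P * (c%:P + V) = 2%:P + d%:P * V by rewrite mulrDr dc.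
  have -> : d%:P ^+ 2 * ((c%:P + V) * V) = (d%:P * c%:P + d%:P * V) * (d%:P * V) by ring.
  by rewrite dc polyC_natr; ring.
rewrite size_polyDl mul_polyC ?size_scale // size_polyN size_poly1 sU.
by rewrite ltnS.
Qed.

Lemma pell_at (x : K) : x != 0 ->
  P.[x] = x ^+ 4 * ((a - x^-1) * (b - x^-1) * (l - x^-1)).
Proof. by move=> x0; rewrite /pell_poly !(hornerM, hornerD, hornerN, hornerX, hornerC); field. Qed.

Lemma P3_roots : [/\ P3.[0] = 0, P3.[a^-1] = 0 & P3.[b^-1] = 0].
Proof. by rewrite !hornerE !mulfV // subrr !(mul0r, mulr0). Qed.

Lemma pell_poly_root x : P3.[x] = 0 -> P.[x] = 0.
Proof. by move=> x0; rewrite /pell_poly hornerM x0 mul0r. Qed.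

(** Replacing [x] by [1 / z] and multiplying by [z ^ n] turns the right side [c x ^ n] of the
    identity into the constant [c]; its two terms become the [U] and [V] of [pellI]. *)
Lemma cayley_pell : cayley a b l n -> pell a b l n.
Proof.
move=> cay; have [q0 q0E] := closed_sqrt (a * b * l).
have [P30 P3a P3b] := P3_roots.
have lX0 : l%:P - 'X != 0 :> {poly K} by rewrite -oppr_eq0 opprB polyXsubC_eq0.
have [p [q [c [c0 p0 _ NE [sp sq pl]]]]] :=
  cayley_normal_form (erefl _) a0 b0 l0 n0 q0E cay.
case: (boolP (odd n)) pl NE sp sq => on pl NE sp sq; last first.
  have nE : n = (n./2).*2 by rewrite even_halfK.
  move: sp sq; rewrite nE uphalf_double -nE; move: (n./2) nE => m nE sp sq.
  (* The shift by 2 compensates, after squaring, the factor [x ^ 4] in [pell_at]. *)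
  have [|g gE] := @reciprocal_shift _ m 2 q; first by rewrite addn2 ltnS.
  apply: (@pellI (reciprocal m p ^+ 2) (g ^+ 2 * P) (reciprocal m p * g) c) => //.
  - by rewrite size_sqr size_reciprocal // nE doubleS.
  - apply: poly_eq_nonzero => x x0; have {}gE := gE _ x0.
    rewrite horner_norm hornerC pell_at //.
    rewrite horner_reciprocal ?sp //.
    have -> : g.[x] = x ^+ m * q.[x^-1] / x ^+ 2 by rewrite -gE mulrC mulKf ?expf_neq0.
    have := congr1 (fun u => u.[x^-1]) NE; rewrite expr0 mulr1.
    rewrite horner_norm [(_ * 'X^_).[_]]hornerM.
    rewrite !(hornerM, hornerXn, hornerD, hornerN, hornerX, hornerC) nE -mul2n mulnC.
    rewrite exprM exprVn => cE.
    have xm0 := expf_neq0 m x0; move: (x ^+ m) xm0 cE => X X0 cE.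
    have -> : c = c * X^-1 ^+ 2 * X ^+ 2 by field.
    by rewrite -cE; field; rewrite x0.
  - by ring.
  - by rewrite hornerM (pell_poly_root P30) mulr0.
  - by rewrite hornerM (pell_poly_root P3a) mulr0.
  - by rewrite hornerM (pell_poly_root P3b) mulr0.
have nE : n = (n./2).*2.+1 by rewrite -[LHS]odd_double_half on.
have ue : uphalf n = (n./2).+1 by rewrite uphalf_half on.
rewrite ue in sp sq; move: (n./2) nE sp sq {ue} => m nE sp sq.
have [ql [A pE]] := pl.
have A0 : A.[0] != 0.
  by apply: contraNneq p0 => A0; rewrite pE hornerM A0 mulr0.
have A00 : A != 0 by apply: contraNneq A0 => ->; rewrite horner0.
have sA : size A = m.+1.
  have sl : size (l%:P - 'X) = 2 by rewrite -size_polyN opprB size_XsubC.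
  by move: sp; rewrite pE (size_mul lX0 A00) sl => -[].
have NE1 : (l%:P - 'X) * A ^+ 2 - q ^+ 2 * ((a%:P - 'X) * (b%:P - 'X)) = c%:P * 'X^n.
  apply: (mulfI lX0); move: NE; rewrite expr1 pE mulrC => NE.
  by rewrite [RHS]mulrC -NE; ring.
(* Here a shift by 1 is right: the cubic [P3] is [x ^ 3] times the product of [a - 1 / x] and
   [b - 1 / x], and one power of [x] belongs to the odd [n]. *)
have [|g gE] := @reciprocal_shift _ m 1 q; first by rewrite addn1 ltnS.
apply: (@pellI ((l%:P * 'X - 1) * reciprocal m A ^+ 2) (g ^+ 2 * P3)
  (reciprocal m A * g) c) => //.
- have R0 : reciprocal m A != 0.
    by rewrite -size_poly_gt0 size_reciprocal.
  have L0 : size (l%:P * 'X - 1) = 2.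
    by rewrite size_polyDl mul_polyC ?size_scale // size_polyX // size_polyN size_poly1.
  rewrite size_mul ?expf_neq0 // -?size_poly_eq0 ?L0 // size_sqr size_reciprocal //.
  by rewrite nE; clear; lia.
- apply: poly_eq_nonzero => x x0; have {}gE := gE _ x0.
  rewrite horner_normM hornerC.
  rewrite horner_reciprocal ?sA //.
  have -> : g.[x] = x ^+ m * q.[x^-1] / x by rewrite -gE mulrC mulKf.
  have := congr1 (fun u => u.[x^-1]) NE1.
  rewrite horner_normM [(_ * 'X^_).[_]]hornerM.
  rewrite !(hornerM, hornerXn, hornerD, hornerN, hornerX, hornerC) nE -mul2n mulnC.
  rewrite [_ ^+ (m * 2).+1]exprS exprM exprVn => cE.
  have xm0 := expf_neq0 m x0; move: (x ^+ m) xm0 cE => X X0 cE.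
  have -> : c = c * (x^-1 * X^-1 ^+ 2) * (x * X ^+ 2) by field; rewrite x0 X0.
  by rewrite -cE; field; rewrite x0.
- by rewrite /pell_poly; ring.
- by rewrite hornerM P30 mulr0.
- by rewrite hornerM P3a mulr0.
- by rewrite hornerM P3b mulr0.
Qed.

(** The factors [U = s + 1] and [V = s - 1] differ by 2, hence are coprime, and their product is
    [t ^ 2 P]. Once the roots of [P] are distributed between them, the cofactors are squares. *)
Lemma pell_cayley : pell a b l n -> cayley a b l n.
Proof.
move=> [s [t [E ss s0 sa sb]]].
pose U := s + 1; pose V := s - 1.
have UV2 : U - V = 2%:P by rewrite /U /V polyC_natr; ring.
have UVE : U * V = t ^+ 2 * P.
  move: (P) E => Q EQ; rewrite /U /V; transitivity (s ^+ 2 - 1); first ring.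
  by rewrite -EQ; ring.
have sU : size U = n.+1 by rewrite size_polyDl ss // size_poly1 ltnS.
have sV : size V = n.+1 by rewrite size_polyDl ss // size_polyN size_poly1 ltnS.
have V0 : V != 0 by rewrite -size_poly_eq0 sV.
have U0 : U != 0 by rewrite -size_poly_eq0 sU.
have t0 : t != 0.
  by apply: contraNneq (mulf_neq0 U0 V0) => t0; rewrite UVE t0 expr0n mul0r.
have cop (W W' u v : {poly K}) : W * u - W' * v = 2%:P -> coprimep u v.
  move=> h; apply/Bezout_eq1_coprimepP; exists (2^-1%:P * W, - (2^-1%:P * W')) => /=.
  have -> : 2^-1%:P * W * u + - (2^-1%:P * W') * v = 2^-1%:P * (W * u - W' * v) by ring.
  by rewrite h -polyCM mulVf.
have lin (c : K) : c != 0 -> c%:P * 'X - 1 = c%:P * ('X - c^-1%:P).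
  by move=> c0; rewrite mulrBr -polyCM mulfV.
have slin (c : K) : c != 0 -> size (c%:P * 'X - 1) = 2.
  by move=> c0; rewrite lin // mul_polyC size_scale // size_XsubC.
have lin0 (c : K) : c != 0 -> c%:P * 'X - 1 != 0.
  by move=> c0; rewrite -size_poly_eq0 slin.
have X0 : 'X != 0 :> {poly K} by rewrite polyX_eq0.
have sP3 : size P3 = 4.
  by rewrite !size_mul ?mulf_neq0 ?lin0 // !slin // size_polyX.
have P30 : P3 != 0 by rewrite -size_poly_eq0 sP3.
have sP : size P = 5 by rewrite size_mul ?lin0 // sP3 slin.
have P0 : P != 0 by rewrite -size_poly_eq0 sP.
have P3V : exists V1, V = P3 * V1.
  have /dvdpP[V1 V1E] : \prod_(z <- [:: 0; a^-1; b^-1]) ('X - z%:P) %| V.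
    apply: uniq_roots_dvdp; first by rewrite /= /root !hornerE s0 sa sb !subrr eqxx.
    rewrite uniq_rootsE /= !inE !(inj_eq invr_inj) eq_sym invr_eq0 (negPf a0).
    by rewrite [0 == _]eq_sym invr_eq0 (negPf b0) ab.
  exists ((a^-1 * b^-1)%:P * V1); rewrite V1E !big_cons big_nil !lin //.
  have e c : c != 0 -> c^-1%:P * c%:P = 1 :> {poly K} by move=> c0; rewrite -polyCM mulVf.
  transitivity ((a^-1%:P * a%:P) * (b^-1%:P * b%:P) * V1 * ('X * ('X - a^-1%:P) * ('X - b^-1%:P))).
    by rewrite !e // subr0; ring.
  by rewrite polyCM; ring.
have [V3 V3E] := P3V.
have P3E : P = P3 * (l%:P * 'X - 1) by [].
have sl2 : s.[l^-1] ^+ 2 = 1.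
  have := congr1 (fun u => u.[l^-1]) E; rewrite horner_norm hornerC => <-; rewrite P3E [P3 * _]mulrC hornerM.
  by rewrite lin // !hornerM hornerXsubC subrr !(mulr0, mul0r) subr0.
(* If [s] is 1 at [1 / l], all of [P] divides [V] and [U] is a square, so [n] is even. If it is -1,
   [U] is [l z - 1] times a square, so [n] is odd. *)
move/eqP: sl2; rewrite -(expr1n _ 2) eqf_sqr => /orP[] /eqP sl.
  have /factor_theorem[V4 V4E] : root V3 l^-1.
    have : root V l^-1 by rewrite /root /V !hornerE sl subrr.
    rewrite V3E rootM => /orP[|//]; rewrite /root !hornerE.
    rewrite !mulf_eq0 invr_eq0 (negPf l0) /=.
    rewrite !subr_eq0 -[1](mulfV l0) !(inj_eq (mulIf _)) ?invr_eq0 //.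
    by rewrite (negPf al) (negPf bl).
  pose V1 := l^-1%:P * V4.
  have VE : V = P * V1.
    rewrite V3E V4E P3E (lin l l0) /V1.
    transitivity (P3 * V4 * ('X - l^-1%:P) * (l%:P * l^-1%:P)).
      by rewrite -polyCM mulfV // mulr1 mulrA.
    by ring.
  have cUV : coprimep U V1 by apply: (cop 1 P); rewrite mul1r -VE.
  have UV1 : U * V1 = t ^+ 2.
    by apply: (mulIf P0); rewrite -UVE VE; ring.
  have [u uE] := coprime_square t0 cUV UV1.
  have [v vE] : exists v, V1 = v ^+ 2.
    by apply: (@coprime_square _ V1 U t) => //; rewrite 1?coprimep_sym // mulrC.
  have u0 : u != 0 by apply: contraNneq U0 => u0; rewrite uE u0 expr0n.
  have V10 : V1 != 0 by apply: contraNneq V0 => V10; rewrite VE V10 mulr0.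
  have v0 : v != 0 by apply: contraNneq V10 => v0; rewrite vE v0 expr0n.
  have su : (0 < size u)%N by rewrite size_poly_gt0.
  have sv : (0 < size v)%N by rewrite size_poly_gt0.
  have [m [nE sue sve]] : exists m, [/\ n = m.+2.*2, size u = m.+3 & size v = m.+1].
    move: sU sV; rewrite VE size_mul // sP uE vE !size_sqr.
    move: su sv; move: (size u) (size v) => i j su sv h1 h2.
    by exists j.-1; move: su sv h1 h2; clear; split; lia.
  exists (reciprocal m.+2 u), (reciprocal m v), 2; split=> //.
    by rewrite reciprocal_at0 -[m.+2]/(m.+3.-1) -sue -lead_coefE lead_coef_eq0.
  have -> : odd n = false by rewrite nE odd_double.
  apply: poly_eq_nonzero => x x0.
  have xn : x ^+ n = (x ^+ m) ^+ 2 * x ^+ 4.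
    by rewrite -exprM -exprD nE; congr (x ^+ _); clear; lia.
  have xi0 : x^-1 != 0 by rewrite invr_eq0.
  rewrite horner_norm [(_ * 'X^_).[_]]hornerM.
  rewrite !(hornerM, hornerXn, hornerD, hornerN, hornerX, hornerC).
  rewrite !horner_reciprocal ?sue ?sve //.
  have := congr1 (fun w => w.[x^-1]) UV2; rewrite uE VE vE [P * _]mulrC.
  rewrite horner_norm hornerC pell_at // invrK => <-.
  rewrite xn -[m.+2]addn2 exprD; move: (x ^+ m) => X.
  by field.
have /factor_theorem[U1' U1E] : root U l^-1.
  by rewrite /root /U !hornerE sl addNr.
pose U1 := l^-1%:P * U1'.
have UE : U = (l%:P * 'X - 1) * U1.
  rewrite U1E lin // /U1.
  transitivity (U1' * ('X - l^-1%:P) * (l%:P * l^-1%:P)).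
    by rewrite -polyCM mulfV // mulr1.
  by ring.
have cUV : coprimep U1 V3 by apply: (cop (l%:P * 'X - 1) P3); rewrite -UE -V3E.
have UV1 : U1 * V3 = t ^+ 2.
  by apply: (mulIf P0); rewrite -UVE UE V3E P3E; ring.
have [u uE] := coprime_square t0 cUV UV1.
have [v vE] : exists v, V3 = v ^+ 2.
  by apply: (@coprime_square _ V3 U1 t) => //; rewrite 1?coprimep_sym // mulrC.
have U10 : U1 != 0 by apply: contraNneq U0 => U10; rewrite UE U10 mulr0.
have V30 : V3 != 0 by apply: contraNneq V0 => V30; rewrite V3E V30 mulr0.
have u0 : u != 0 by apply: contraNneq U10 => u0; rewrite uE u0 expr0n.
have v0 : v != 0 by apply: contraNneq V30 => v0; rewrite vE v0 expr0n.
have su : (0 < size u)%N by rewrite size_poly_gt0.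
have sv : (0 < size v)%N by rewrite size_poly_gt0.
have [m [nE sue sve]] : exists m, [/\ n = m.+1.*2.+1, size u = m.+2 & size v = m.+1].
  move: sU sV; rewrite UE V3E (size_mul (lin0 l l0) U10) (size_mul P30 V30) sP3 (slin l l0) uE vE !size_sqr.
  move: su sv; move: (size u) (size v) => i j su sv h1 h2.
  by exists j.-1; move: su sv h1 h2; clear; split; lia.
exists (reciprocal m.+1 u), (reciprocal m v), 2; split=> //.
  by rewrite reciprocal_at0 -[m.+1]/(m.+2.-1) -sue -lead_coefE lead_coef_eq0.
have -> : odd n = true by rewrite nE /= odd_double.
apply: poly_eq_nonzero => x x0.
have xn : x ^+ n = (x ^+ m) ^+ 2 * x ^+ 3.
  by rewrite -exprM -exprD nE; congr (x ^+ _); clear; lia.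
have xi0 : x^-1 != 0 by rewrite invr_eq0.
rewrite horner_normM [(_ * 'X^_).[_]]hornerM.
rewrite !(hornerM, hornerXn, hornerD, hornerN, hornerX, hornerC).
rewrite !horner_reciprocal ?sue ?sve //.
have := congr1 (fun w => w.[x^-1]) UV2; rewrite UE uE V3E vE [P3 * _]mulrC.
rewrite horner_normM hornerC.
rewrite !(hornerM, hornerD, hornerN, hornerX, hornerC) => <-.
rewrite xn -[m.+1]addn1 exprD; move: (x ^+ m) => X.
by field.
Qed.

End Pell.

(** * The Lax representation *)

Section Mat2.
Variable R : comNzRingType.

Record mat2 := Mat2 { m11 : R; m12 : R; m21 : R; m22 : R }.

Definition mat2_mul (A B : mat2) : mat2 :=
  Mat2 (m11 A * m11 B + m12 A * m21 B) (m11 A * m12 B + m12 A * m22 B)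
       (m21 A * m11 B + m22 A * m21 B) (m21 A * m12 B + m22 A * m22 B).
Definition mat2_det (A : mat2) : R := m11 A * m22 A - m12 A * m21 A.
Definition mat2_adj (A : mat2) : mat2 := Mat2 (m22 A) (- m12 A) (- m21 A) (m11 A).
Definition mat2_scalar (c : R) : mat2 := Mat2 c 0 0 c.
(* [c + d * A] *)
Definition mat2_pencil (c d : R) (A : mat2) : mat2 :=
  Mat2 (c + d * m11 A) (d * m12 A) (d * m21 A) (c + d * m22 A).

Lemma mat2_mulA A B C : mat2_mul A (mat2_mul B C) = mat2_mul (mat2_mul A B) C.
Proof. by rewrite /mat2_mul /=; congr Mat2; ring. Qed.

Lemma mat2_mul1 A : mat2_mul (mat2_scalar 1) A = A.
Proof. by case: A => a b c d; rewrite /mat2_mul /=; congr Mat2; ring. Qed.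

Lemma mat2_det_mul A B : mat2_det (mat2_mul A B) = mat2_det A * mat2_det B.
Proof. by rewrite /mat2_det /=; ring. Qed.

Lemma mat2_mul_adj A : mat2_mul A (mat2_adj A) = mat2_scalar (mat2_det A).
Proof. by rewrite /mat2_mul /mat2_scalar /mat2_det /=; congr Mat2; ring. Qed.

Lemma mat2_adj_mul A B : mat2_adj (mat2_mul A B) = mat2_mul (mat2_adj B) (mat2_adj A).
Proof. by rewrite /mat2_adj /mat2_mul /=; congr Mat2; ring. Qed.

Lemma mat2_scalarC c A : mat2_mul (mat2_scalar c) A = mat2_mul A (mat2_scalar c).
Proof. by rewrite /mat2_mul /=; congr Mat2; ring. Qed.

End Mat2.

Section Step.
Variables (R : comNzRingType) (a b z : R).

(** The polar form of the confocal conic of parameter [1 / z], multiplied by [(a z - 1) (b z - 1)]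
    to clear denominators. *)
Definition conf_form (u1 u2 w1 w2 : R) : R :=
  z * (u1 * w1 * (b * z - 1) + u2 * w2 * (a * z - 1)) - (a * z - 1) * (b * z - 1).

(** A line is tangent to a conic when the discriminant of the form along it vanishes. The hypothesis
    is tangency to the conic of parameter [l], which accounts for the root [1 / l]; at the roots
    [0], [1 / a], [1 / b] the form has rank one. *)
Lemma conf_form_disc l x1 x2 y1 y2 :
  (x1 * y2 - x2 * y1) ^+ 2 = (y1 - x1) ^+ 2 * (b - l) + (y2 - x2) ^+ 2 * (a - l) ->
  conf_form x1 x2 y1 y2 ^+ 2 - conf_form x1 x2 x1 x2 * conf_form y1 y2 y1 y2 =
  ((y1 - x1) ^+ 2 + (y2 - x2) ^+ 2) * (z * (a * z - 1) * (b * z - 1) * (l * z - 1)).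
Proof.
move=> h; transitivity (z * (a * z - 1) * (b * z - 1) *
  (z * (b * (y1 - x1) ^+ 2 + a * (y2 - x2) ^+ 2 - (x1 * y2 - x2 * y1) ^+ 2) -
   ((y1 - x1) ^+ 2 + (y2 - x2) ^+ 2))); first by rewrite /conf_form; ring.
by rewrite h; ring.
Qed.

(* [(e1, e2)] is the normal of the ellipse at [(a * e1, b * e2)]; in the pencil,
   it acts as [z] times that point. *)
Variables (e1 e2 x1 x2 s m g : R).
Hypotheses (H1 : a * e1 ^+ 2 + b * e2 ^+ 2 = 1) (H2 : 1 - (e1 * x1 + e2 * x2) = g)
  (H3 : m * (e1 ^+ 2 + e2 ^+ 2) = - 2%:R * s * g).
Let y1 := a * e1.
Let y2 := b * e2.
Let w1 := - s * x1 + (1 + s) * y1 + m * e1.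
Let w2 := - s * x2 + (1 + s) * y2 + m * e2.

(** In the form, [w] behaves like [- s x + (1 + s + m z) y]; the discrepancy is an explicit multiple
    of the equation of the ellipse at [y]. *)
Lemma conf_form_step12 : conf_form y1 y2 w1 w2 =
  - s * conf_form x1 x2 y1 y2 + (1 + s + m * z) * conf_form y1 y2 y1 y2.
Proof.
apply/eqP; rewrite -subr_eq0; apply/eqP.
transitivity (- (m * z * (a * z - 1) * (b * z - 1)) * (a * e1 ^+ 2 + b * e2 ^+ 2 - 1)).
  by rewrite /conf_form /w1 /w2 /y1 /y2; ring.
by rewrite H1 subrr mulr0.
Qed.

Lemma conf_form_step22 : conf_form w1 w2 w1 w2 =
  s ^+ 2 * conf_form x1 x2 x1 x2 - 2%:R * s * (1 + s + m * z) * conf_form x1 x2 y1 y2 +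
  (1 + s + m * z) ^+ 2 * conf_form y1 y2 y1 y2.
Proof.
apply/eqP; rewrite -subr_eq0; apply/eqP.
transitivity (- (m * z * (a * z - 1) * (b * z - 1)) *
  (2%:R * s * (1 - (e1 * x1 + e2 * x2)) + m * (e1 ^+ 2 + e2 ^+ 2) +
   (2%:R + 2%:R * s + m * z) * (a * e1 ^+ 2 + b * e2 ^+ 2 - 1))).
  by rewrite /conf_form /w1 /w2 /y1 /y2; ring.
by rewrite H1 H2 H3; ring.
Qed.

Lemma step_gap : 1 - (e1 * w1 + e2 * w2) = s * g.
Proof.
transitivity (- s * (1 - (e1 * x1 + e2 * x2)) + (1 + s) * (1 - (a * e1 ^+ 2 + b * e2 ^+ 2)) +
   2%:R * s * (1 - (e1 * x1 + e2 * x2)) - (m * (e1 ^+ 2 + e2 ^+ 2) + 2%:R * s * g) +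
   2%:R * s * (g - (1 - (e1 * x1 + e2 * x2)))).
  by rewrite /w1 /w2 /y1 /y2; ring.
by rewrite H1 H2 H3; ring.
Qed.

End Step.

(** * Lax matrices and monodromy along a trajectory *)

Section Chain.
Variables (F : fieldType) (a b l rho : F) (p : nat -> F * F) (s m g : nat -> F).
Hypothesis two : (2%:R : F) != 0.
Hypotheses (a0 : a != 0) (b0 : b != 0) (l0 : l != 0).
Hypotheses (rho0 : rho != 0) (rhoE : rho ^+ 2 = a * b / l).
Local Notation x k := (p k).1.
Local Notation y k := (p k).2.
Hypothesis hE : forall k, x k ^+ 2 / a + y k ^+ 2 / b = 1.
Hypothesis hG : forall k, 1 - (x k * x k.+1 / a + y k * y k.+1 / b) = g k.
Hypothesis g0 : forall k, g k != 0.
Hypothesis s0 : forall k, s k != 0.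
Hypothesis m0 : forall k, m k != 0.
Hypothesis hx : forall k,
  x k.+2 = - s k * x k + (1 + s k) * x k.+1 + m k * (x k.+1 / a).
Hypothesis hy : forall k,
  y k.+2 = - s k * y k + (1 + s k) * y k.+1 + m k * (y k.+1 / b).
Hypothesis hm : forall k,
  m k * ((x k.+1 / a) ^+ 2 + (y k.+1 / b) ^+ 2) = - 2%:R * s k * g k.
Hypothesis hW : (x 0 * y 1 - y 0 * x 1) ^+ 2 =
  (x 1 - x 0) ^+ 2 * (b - l) + (y 1 - y 0) ^+ 2 * (a - l).
Hypothesis hV : (x 1 - x 0) ^+ 2 + (y 1 - y 0) ^+ 2 = rho ^+ 2 * g 0 ^+ 2.

Local Notation P := (pell_poly a b l).

Definition gram i j : {poly F} :=
  conf_form a%:P b%:P 'X (x i)%:P (y i)%:P (x j)%:P (y j)%:P.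

(** It acts on row vectors from the right, sending [(r k, r k.+1)] to [(r k.+1, r k.+2)]. *)
Definition transfer k : mat2 {poly F} :=
  Mat2 0 (- (s k)%:P) 1 (1 + (s k)%:P + (m k)%:P * 'X).

(** The Gram matrix of two consecutive vertices, multiplied by the standard symplectic matrix: the
    trace is zero, so the square is the scalar discriminant. The factor normalizes the chord length,
    which is [rho] times the gap. *)
Definition lax k : mat2 {poly F} := let c := ((g k * rho)^-1)%:P in
  Mat2 (c * gram k k.+1) (c * gram k.+1 k.+1) (- (c * gram k k)) (- (c * gram k k.+1)).

Lemma gap_step k : g k.+1 = s k * g k.
Proof.
have := @step_gap F a b (x k.+1 / a) (y k.+1 / b) (x k) (y k) (s k) (m k) (g k).
rewrite -(hG k.+1) hx hy => h; rewrite -h.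
- by field; rewrite a0 b0.
- by rewrite -(hE k.+1); field; rewrite a0 b0.
- by rewrite -hG; ring.
by rewrite hm.
Qed.

(** The Gram matrix [G] changes to [T^t G T], and [T J T^t = det T J] for the symplectic matrix [J].
    Since [det T = s k], the normalizing factors absorb the determinant, by [gap_step]. *)
Lemma lax_step k : mat2_mul (transfer k) (lax k.+1) = mat2_mul (lax k) (transfer k).
Proof.
have [e1 e1E] : exists e1, e1 = x k.+1 / a by eexists.
have [e2 e2E] : exists e2, e2 = y k.+1 / b by eexists.
have x1E : x k.+1 = a * e1 by rewrite e1E mulrCA divff // mulr1.
have y1E : y k.+1 = b * e2 by rewrite e2E mulrCA divff // mulr1.
have h1 : a * e1 ^+ 2 + b * e2 ^+ 2 = 1.
  by rewrite -(hE k.+1) x1E y1E; field; rewrite a0 b0.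
have h2 : 1 - (e1 * x k + e2 * y k) = g k by rewrite -hG e1E e2E; ring.
have h3 : m k * (e1 ^+ 2 + e2 ^+ 2) = - 2%:R * s k * g k by rewrite e1E e2E hm.
have H1 := congr1 polyC h1; have H2 := congr1 polyC h2; have H3 := congr1 polyC h3.
rewrite !(polyC_exp, polyCD, polyCM, polyCN, polyC1, polyC_natr) in H1 H2 H3.
have S12 := conf_form_step12 'X (x k)%:P (y k)%:P (s k)%:P (m k)%:P H1.
have S22 := conf_form_step22 'X H1 H2 H3.
have G12 : gram k.+1 k.+2 = - (s k)%:P * gram k k.+1 +
    (1 + (s k)%:P + (m k)%:P * 'X) * gram k.+1 k.+1.
  rewrite /gram hx hy -e1E -e2E x1E y1E.
  by rewrite !(polyCD, polyCM, polyCN, polyC1) S12.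
have G22 : gram k.+2 k.+2 = (s k)%:P ^+ 2 * gram k k -
    2%:R * (s k)%:P * (1 + (s k)%:P + (m k)%:P * 'X) * gram k k.+1 +
    (1 + (s k)%:P + (m k)%:P * 'X) ^+ 2 * gram k.+1 k.+1.
  rewrite /gram hx hy -e1E -e2E x1E y1E.
  by rewrite !(polyCD, polyCM, polyCN, polyC1) S22.
have cE : ((g k * rho)^-1)%:P = (s k)%:P * ((g k.+1 * rho)^-1)%:P.
  by rewrite -polyCM gap_step; congr _%:P; field; rewrite s0 g0 rho0.
rewrite /mat2_mul /lax /transfer /= G12 G22 cE.
move: (((g k.+1 * rho)^-1)%:P) => c.
by congr Mat2; ring.
Qed.

Fixpoint monodromy n : mat2 {poly F} :=
  if n is k.+1 then mat2_mul (monodromy k) (transfer k) else mat2_scalar 1.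

Lemma monodromy_lax n :
  mat2_mul (monodromy n) (lax n) = mat2_mul (lax 0) (monodromy n).
Proof.
elim: n => [|n IH]; first by rewrite mat2_scalarC.
by rewrite /= -mat2_mulA lax_step mat2_mulA IH mat2_mulA.
Qed.

Lemma monodromy_row (c : F) (r : nat -> F) :
    (forall k, r k.+2 = - s k * r k + (1 + s k + m k * c) * r k.+1) ->
  forall n, r n = r 0 * (m11 (monodromy n)).[c] + r 1 * (m21 (monodromy n)).[c] /\
    r n.+1 = r 0 * (m12 (monodromy n)).[c] + r 1 * (m22 (monodromy n)).[c].
Proof.
move=> hr; elim=> [|n [IH1 IH2]] /=; first by rewrite !hornerC; split; ring.
split; first by rewrite !mulr0 !add0r !mulr1.
rewrite hr IH1 IH2 !(hornerD, hornerM, hornerN, hornerC, hornerX).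
by ring.
Qed.

Lemma monodromy_x n :
  x n = x 0 * (m11 (monodromy n)).[a^-1] + x 1 * (m21 (monodromy n)).[a^-1] /\
  x n.+1 = x 0 * (m12 (monodromy n)).[a^-1] + x 1 * (m22 (monodromy n)).[a^-1].
Proof. by apply: (@monodromy_row a^-1 (fun k => x k)) => k; rewrite hx; ring. Qed.

Lemma monodromy_y n :
  y n = y 0 * (m11 (monodromy n)).[b^-1] + y 1 * (m21 (monodromy n)).[b^-1] /\
  y n.+1 = y 0 * (m12 (monodromy n)).[b^-1] + y 1 * (m22 (monodromy n)).[b^-1].
Proof. by apply: (@monodromy_row b^-1 (fun k => y k)) => k; rewrite hy; ring. Qed.

Lemma monodromy_0 n :
  1 = (m11 (monodromy n)).[0] + (m21 (monodromy n)).[0] /\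
  1 = (m12 (monodromy n)).[0] + (m22 (monodromy n)).[0].
Proof.
have [|h1 h2] := @monodromy_row 0 (fun=> 1) _ n; first by move=> k; ring.
by split; [rewrite {1}h1|rewrite {1}h2]; ring.
Qed.

Lemma monodromy_det n : exists2 d, d != 0 & mat2_det (monodromy n) = d%:P.
Proof.
elim: n => [|n [d d0 IH]].
  by exists 1; rewrite ?oner_neq0 // /mat2_det /=; ring.
exists (d * s n); first by rewrite mulf_neq0.
by rewrite /= mat2_det_mul IH /mat2_det /= polyCM; ring.
Qed.

Definition size_le (A : mat2 {poly F}) i :=
  [/\ (size (m11 A) <= i)%N, (size (m12 A) <= i)%N, (size (m21 A) <= i)%N &
      (size (m22 A) <= i)%N].

Lemma size_mul_le (u v : {poly F}) i j :
  (size u <= i.+1)%N -> (size v <= j.+1)%N -> (size (u * v)%R <= (i + j).+1)%N.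
Proof.
move=> ui vj; apply: leq_trans (size_polyMleq _ _) _.
by move: ui vj; move: (size u) (size v) => i' j'; clear; lia.
Qed.

Lemma coef_mul_top (u v : {poly F}) i j : (size u <= i.+1)%N -> (size v <= j.+1)%N ->
  (u * v)`_(i + j) = u`_i * v`_j.
Proof.
move=> ui vj; rewrite coefM (bigD1 (inord i)) //= inordK ?ltnS ?leq_addr //.
rewrite addKn big1 ?addr0 // => k; rewrite -val_eqE /= inordK ?ltnS ?leq_addr // => ki.
have [lt|ge] := ltnP k i.
  rewrite [v`_ _]nth_default ?mulr0 // (leq_trans vj) //.
  by move: lt (ltn_ord k); move: (k : nat) => k'; clear; lia.
rewrite [u`_ _]nth_default ?mul0r // (leq_trans ui) //.
by move: ge ki; move: (k : nat) => k'; clear; lia.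
Qed.

Lemma size_add_le (u v : {poly F}) i :
  (size u <= i)%N -> (size v <= i)%N -> (size (u + v)%R <= i)%N.
Proof. by move=> ui vi; rewrite (leq_trans (size_polyD _ _)) // geq_max ui vi. Qed.

Lemma monodromy_size n : size_le (monodromy n) n.+1.
Proof.
elim: n => [|n [h11 h12 h21 h22]] /=.
  by split; rewrite /= ?size_poly0 ?size_poly1.
have t2 : (size (1 + (s n)%:P + (m n)%:P * 'X)%R <= 2)%N.
  rewrite -polyC1 -polyCD; apply: size_add_le.
    by rewrite (leq_trans (size_polyC_leq1 _)).
  by rewrite mul_polyC (leq_trans (size_scale_leq _ _)) // size_polyX.
have t1 : (size (- (s n)%:P : {poly F}) <= 2)%N.
  by rewrite size_polyN (leq_trans (size_polyC_leq1 _)).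
split=> /=; rewrite ?mulr0 ?mulr1 ?add0r ?(leq_trans h12) ?(leq_trans h22) //;
by apply: size_add_le; rewrite -addn1; apply: size_mul_le.
Qed.

(** The variable occurs only in the lower right entry of a transfer matrix, so the coefficient of
    degree [n] there is the product of the [m k]. *)
Lemma monodromy_top n : [/\ (m11 (monodromy n.+1))`_n.+1 = 0 &
  (m22 (monodromy n))`_n != 0].
Proof.
split; first by have [_ h12 _ _] := monodromy_size n; rewrite /= mulr0 add0r mulr1 nth_default.
elim: n => [|n IH] /=; first by rewrite coefC oner_neq0.
have [_ _ h21 h22] := monodromy_size n.
rewrite coefD mulrN coefN coefMC nth_default // mul0r oppr0 add0r.
rewrite -polyC1 -polyCD mulrDr coefD coefMC nth_default // mul0r add0r.
by rewrite mulrCA mulrA coefMX /= coefCM mulf_neq0.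
Qed.

Lemma gram_coef i j :
  (size (gram i j) <= 3)%N /\ (gram i j)`_2 = b * (x i * x j) + a * (y i * y j) - a * b.
Proof.
have -> : gram i j = (b * (x i * x j) + a * (y i * y j) - a * b)%:P * 'X^2 +
    ((a + b - x i * x j - y i * y j)%:P * 'X + (-1)%:P).
  by rewrite /gram /conf_form !(polyCD, polyCM, polyCN, polyC1); ring.
have h (c d : F) : (size (c%:P * 'X + d%:P)%R <= 2)%N by rewrite size_MXaddC; case: ifP => // _; rewrite ltnS size_polyC_leq1.
split; last by rewrite coefD coefCM coefXn mulr1 [X in _ + X]nth_default ?addr0.
apply: size_add_le; last exact: leq_trans (h _ _) _.
by rewrite mul_polyC (leq_trans (size_scale_leq _ _)) // size_polyXn.
Qed.

(** A vertex lies on the ellipse, the member of the family at [z = oo], so the quadratic term drops.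
    The inverse of the remaining root is the second elliptic coordinate of the vertex. *)
Lemma gram_diag k : gram k k = (a + b - x k ^+ 2 - y k ^+ 2)%:P * 'X - 1.
Proof.
have e : b * x k ^+ 2 + a * y k ^+ 2 = a * b.
  by rewrite -[RHS]mulr1 -(hE k); field; rewrite a0 b0.
have := congr1 polyC e; rewrite !(polyC_exp, polyCD, polyCM) => e'.
transitivity ((b%:P * (x k)%:P ^+ 2 + a%:P * (y k)%:P ^+ 2 - a%:P * b%:P) * 'X^2 +
  ((a%:P + b%:P - (x k)%:P ^+ 2 - (y k)%:P ^+ 2) * 'X - 1)).
  by rewrite /gram /conf_form; ring.
by rewrite e' subrr mul0r add0r !(polyC_exp, polyCD, polyCN).
Qed.

(** At [z = oo] the matrix is asymptotic to [z ^ 2] times a diagonal matrix independent of [k]; this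
    allows [lax 0] and [lax n] to be compared before the trajectory is known to close. *)
Lemma lax_coef k : size_le (lax k) 3 /\
  [/\ (m11 (lax k))`_2 = - (a * b / rho), (m12 (lax k))`_2 = 0,
      (m21 (lax k))`_2 = 0 & (m22 (lax k))`_2 = a * b / rho].
Proof.
have [s12 c12] := gram_coef k k.+1.
have d2 i : (gram i i)`_2 = 0 by rewrite gram_diag !coefE mulr0 subr0.
have [s11 _] := gram_coef k k; have [s22 _] := gram_coef k.+1 k.+1.
have sc c i j : (size (gram i j) <= 3)%N -> (size (c%:P * gram i j)%R <= 3)%N.
  by rewrite mul_polyC; apply/leq_trans/size_scale_leq.
split; first by split; rewrite /= ?size_polyN sc.
have e : (g k * rho)^-1 * (gram k k.+1)`_2 = - (a * b / rho).
  rewrite c12; have -> : b * (x k * x k.+1) + a * (y k * y k.+1) - a * b = - (a * b) * g k.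
    by rewrite -hG; field; rewrite a0 b0.
  by field; rewrite rho0 g0.
split; rewrite /= ?coefN coefCM ?e ?d2 ?mulr0 ?oppr0 //.
by rewrite opprK.
Qed.

Lemma lax_sqr : m11 (lax 0) ^+ 2 + m12 (lax 0) * m21 (lax 0) = P /\
  m22 (lax 0) = - m11 (lax 0).
Proof.
split=> //=.
have h := congr1 polyC hW; have hv := congr1 polyC hV.
rewrite !(polyC_exp, polyCD, polyCM, polyCN) in h hv.
have := conf_form_disc 'X h; rewrite hv => e.
transitivity (((g 0 * rho)^-1)%:P ^+ 2 *
  (gram 0 1 ^+ 2 - gram 0 0 * gram 1 1)); first by ring.
rewrite e -/(pell_poly a b l) mulrA -!polyC_exp -!polyCM.
have -> : (g 0 * rho)^-1 ^+ 2 * (rho ^+ 2 * g 0 ^+ 2) = 1.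
  by field; rewrite rho0 g0.
by rewrite mul1r.
Qed.

(** Here and in the next two lemmas the Gram matrix has rank one: it is proportional to the products
    of the entries of [(1, 1)], [(x 0, x 1)] or [(y 0, y 1)], and this row is killed by the
    symplectic twist. *)
Lemma lax_row0 : (m11 (lax 0)).[0] + (m21 (lax 0)).[0] = 0 /\
  (m12 (lax 0)).[0] + (m22 (lax 0)).[0] = 0.
Proof.
have e i j : (gram i j).[0] = -1.
  by rewrite /gram /conf_form !(hornerD, hornerM, hornerN, hornerC, hornerX); ring.
by rewrite /= !(hornerN, hornerM, hornerC) !e !subrr.
Qed.

Lemma lax_row_x :
  x 0 * (m11 (lax 0)).[a^-1] + x 1 * (m21 (lax 0)).[a^-1] = 0 /\
  x 0 * (m12 (lax 0)).[a^-1] + x 1 * (m22 (lax 0)).[a^-1] = 0.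
Proof.
have e i j : (gram i j).[a^-1] = x i * x j * (a^-1 * (b / a - 1)).
  rewrite /gram /conf_form !(hornerD, hornerM, hornerN, hornerC, hornerX).
  by field; rewrite a0.
by rewrite /= !(hornerN, hornerM, hornerC) !e; split; ring.
Qed.

Lemma lax_row_y :
  y 0 * (m11 (lax 0)).[b^-1] + y 1 * (m21 (lax 0)).[b^-1] = 0 /\
  y 0 * (m12 (lax 0)).[b^-1] + y 1 * (m22 (lax 0)).[b^-1] = 0.
Proof.
have e i j : (gram i j).[b^-1] = y i * y j * (b^-1 * (a / b - 1)).
  rewrite /gram /conf_form !(hornerD, hornerM, hornerN, hornerC, hornerX).
  by field; rewrite b0.
by rewrite /= !(hornerN, hornerM, hornerC) !e; split; ring.
Qed.

Lemma pell_size n (u t : {poly F}) : (0 < n)%N -> u ^+ 2 - t ^+ 2 * P = 1 ->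
  size u = n.+1 -> [/\ (1 < n)%N, size t = n.-1 & u`_n ^+ 2 = a * b * l * t`_n.-2 ^+ 2].
Proof.
move=> n0 E su.
have PE : P = (a * b * l)%:P * 'X^4 + ((- (a * b + a * l + b * l))%:P * 'X^3 +
    ((a + b + l)%:P * 'X^2 + (-1)%:P * 'X)).
  by rewrite /pell_poly !(polyCD, polyCM, polyCN, polyC1); ring.
have abl0 : a * b * l != 0 by rewrite !mulf_neq0.
have sP : size P = 5.
  have s4 : size ((a * b * l)%:P * 'X^4) = 5 by rewrite mul_polyC size_scale // size_polyXn.
  have sc (c : F) i : (size (c%:P * 'X^i)%R <= i.+1)%N.
    by rewrite mul_polyC (leq_trans (size_scale_leq _ _)) // size_polyXn.
  rewrite PE size_polyDl s4 // ltnS; apply: size_add_le; first exact: sc.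
  by apply: size_add_le; [exact: leq_trans (sc _ _) _ | exact: leq_trans (sc _ 1) _].
have P0 : P != 0 by rewrite -size_poly_eq0 sP.
have P4 : P`_4 = a * b * l by rewrite PE !coefE /= !mulr0 !addr0 mulr1.
have su2 : size (u ^+ 2) = (n + n).+1.
  have u0 : u != 0 by rewrite -size_poly_eq0 su.
  by rewrite expr2 (size_mul u0 u0) su addnS.
have tE : t ^+ 2 * P = u ^+ 2 - 1 by rewrite -E; ring.
have st2 : size (t ^+ 2 * P) = (n + n).+1.
  rewrite tE size_polyDl su2 // size_polyN size_poly1.
  by move: n0; clear; lia.
have t0 : t != 0 by apply: contra_eq_neq st2 => ->; rewrite expr0n mul0r size_poly0.
have st : (0 < size t)%N by rewrite size_poly_gt0.
have : size (t ^+ 2 * P) = ((size t + size t).-1 + 5).-1.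
  by rewrite (size_mul (expf_neq0 2 t0) P0) sP expr2 (size_mul t0 t0).
rewrite st2 => e.
have [n1 stE] : (1 < n)%N /\ size t = n.-1.
  by move: st n0 e; move: (size t) => i; clear; lia.
split=> //.
have nn : (n + n = n.-2 + n.-2 + 4)%N by move: n1; clear; lia.
have := congr1 (fun q : {poly F} => q`_(n + n)) tE; rewrite coefB coef1.
have -> : (n + n == 0)%N = false by move: n0; clear; lia.
rewrite subr0 [u ^+ 2]expr2 [RHS]coef_mul_top ?su // -[u`_n * _]expr2 => <-.
have s1 : (size t <= n.-2.+1)%N by rewrite stE; move: n1; clear; lia.
have sP' : (size P <= 5)%N by rewrite sP.
by rewrite nn expr2 (coef_mul_top (size_mul_le s1 s1) sP') (coef_mul_top s1 s1) P4 -expr2 mulrC.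
Qed.

Let gamma := a * b / rho.
Let gamma0 : gamma != 0. Proof. by rewrite !mulf_neq0 ?invr_eq0. Qed.
Let gamma2 : gamma ^+ 2 = a * b * l.
Proof. by rewrite /gamma expr_div_n rhoE; field; rewrite a0 b0 l0. Qed.

(** The matrix [K = (u - t L) N] measures how far [N] is from [u + t L]; the aim is [K = 1]. It
    intertwines [lax n] with [lax 0], whose leading terms agree, and this drives its degree down to
    zero. *)
Lemma pell_periodic n (u t : {poly F}) : (0 < n)%N ->
  u ^+ 2 - t ^+ 2 * P = 1 -> size u = n.+1 -> u.[0] = 1 -> u.[a^-1] = 1 ->
  u.[b^-1] = 1 -> p n = p 0.
Proof.
(* This is the top coefficient of the lower right entry of [u + t L]. The coefficients for [t] and
   [- t] add up to twice that of [u], so one of them is nonzero. *)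
move=> n0; wlog ut : t / u`_n + t`_n.-2 * gamma != 0 => [hw E su u0 ua ub|].
  have [ut|ut] := eqVneq (u`_n + t`_n.-2 * gamma) 0; last exact: (hw t).
  apply: (hw (- t)) => //; last by rewrite sqrrN.
  have un0 : u`_n != 0.
    have -> : n = (size u).-1 by rewrite su.
    by rewrite -lead_coefE lead_coef_eq0 -size_poly_eq0 su.
  have tE : t`_n.-2 * gamma = - u`_n by apply/eqP; rewrite -addr_eq0 addrC ut.
  by rewrite coefN mulNr tE opprK -mulr2n -mulr_natl mulf_neq0.
move=> E su u0 ua ub; have [n1 st _] := pell_size n0 E su.
have [N NE] : exists N, N = monodromy n by eexists.
have [L LE] : exists L, L = lax 0 by eexists.
have NL : mat2_mul N (lax n) = mat2_mul L N by rewrite NE LE monodromy_lax.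
have [LP L22] := lax_sqr; rewrite -LE in LP L22.
have [M ME] : exists M, M = mat2_pencil u t L by eexists.
have [M' M'E] : exists M', M' = mat2_pencil u (- t) L by eexists.
have MM' : mat2_mul M M' = mat2_scalar 1.
  by rewrite -E -LP ME M'E /mat2_mul /mat2_pencil /mat2_scalar /= L22; congr Mat2; ring.
have adjM' : mat2_adj M' = M.
  by rewrite ME M'E /mat2_adj /mat2_pencil /= L22; congr Mat2; ring.
have [K KE] : exists K, K = mat2_mul M' N by eexists.
have MK : mat2_mul M K = N by rewrite KE mat2_mulA MM' mat2_mul1.
have KL : mat2_mul K (lax n) = mat2_mul L K.
  rewrite KE -mat2_mulA NL !mat2_mulA; congr (mat2_mul _ _).
  by rewrite M'E /mat2_mul /mat2_pencil /=; congr Mat2; ring.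
have [d d0 dE] := monodromy_det n; rewrite -NE in dE.
have NK : mat2_mul N (mat2_adj K) = mat2_mul (mat2_scalar d%:P) M.
  by rewrite KE mat2_adj_mul adjM' mat2_mulA mat2_mul_adj dE.
have [sN11 sN12 sN21 sN22] := monodromy_size n; rewrite -NE in sN11 sN12 sN21 sN22.
have [[sL11 sL12 sL21 sL22] [cL11 cL12 cL21 cL22]] := lax_coef 0.
have [[sl11 sl12 sl21 sl22] [cl11 cl12 cl21 cl22]] := lax_coef n.
rewrite -LE -/gamma in sL11 sL12 sL21 sL22 cL11 cL12 cL21 cL22.
rewrite -/gamma in cl11 cl22.
have n2 : (n = n.-2 + 2)%N by move: n1; clear; lia.
have st' : (size t <= n.-2.+1)%N by rewrite st; move: n1; clear; lia.
have sM21 : (size (m21 M) <= n.+1)%N by have := size_mul_le st' sL21; rewrite -n2 ME.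
have sM22 : (size (m22 M) <= n.+1)%N.
  rewrite ME /=; apply: size_add_le; first by rewrite su.
  by have := size_mul_le st' sL22; rewrite -n2.
have cM22 : (m22 M)`_n = u`_n + t`_n.-2 * gamma.
  by rewrite ME /= coefD; congr (_ + _); have := coef_mul_top st' sL22; rewrite -n2 cL22.
have [_ N22t] := monodromy_top n; rewrite -NE in N22t.
(* The leading matrix of both Lax matrices has the distinct eigenvalues [- gamma] and [gamma], so
   the top coefficient of [K], commuting with it, is diagonal. *)
have off i : size_le K i.+1 -> (m12 K)`_i = 0 /\ (m21 K)`_i = 0.
  move=> [k11 k12 k21 k22].
  have e12 := congr1 (fun A : mat2 {poly F} => (m12 A)`_(i + 2)) KL.
  have e21 := congr1 (fun A : mat2 {poly F} => (m21 A)`_(i + 2)) KL.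
  move: e12 e21; rewrite /= !coefD [in RHS]addnC.
  rewrite (coef_mul_top k11 sl12) (coef_mul_top k12 sl22).
  rewrite (coef_mul_top sL11 k12) (coef_mul_top sL12 k22).
  rewrite cl12 cl22 cL11 cL12 mulr0 mul0r add0r addr0 mulNr mulrC => e12.
  rewrite [in RHS]addnC (coef_mul_top k21 sl11) (coef_mul_top k22 sl21).
  rewrite (coef_mul_top sL21 k11) (coef_mul_top sL22 k21).
  rewrite cl11 cl21 cL21 cL22 mulr0 mul0r add0r addr0 mulrN mulrC => e21.
  have z (v : F) : gamma * v = - (gamma * v) -> v = 0.
    move=> /eqP; rewrite -addr_eq0 -mulr2n -mulr_natl mulf_eq0 (negPf two).
    by rewrite mulf_eq0 (negPf gamma0) => /eqP.
  by split; apply: z => //; rewrite -e21 opprK.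
have top (q : {poly F}) i : (size q <= i.+1)%N -> q`_i = 0 -> (size q <= i)%N.
  move=> sq qi; apply/leq_sizeP => j; rewrite leq_eqVlt => /orP[/eqP <- //|ij].
  by rewrite nth_default // (leq_trans sq).
(* A nonzero diagonal coefficient of positive degree in [K] would give [M K = N] or [N adj(K) = d M]
   an entry of degree above [n]. *)
have red i : size_le K i.+2 -> size_le K i.+1.
  move=> sK; have [k12z k21z] := off _ sK; have [k11 k12 k21 k22] := sK.
  have big (q : {poly F}) : (size q <= n.+1)%N -> q`_(n + i.+1) = 0.
    by move=> sq; rewrite nth_default // (leq_trans sq) // addnS ltnS leq_addr.
  have k22z : (m22 K)`_i.+1 = 0.
    have := congr1 (fun A : mat2 {poly F} => (m22 A)`_(n + i.+1)) MK.
    rewrite (big _ sN22) /= coefD (coef_mul_top sM21 k12) (coef_mul_top sM22 k22).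
    by rewrite k12z mulr0 add0r => /eqP; rewrite cM22 mulf_eq0 (negPf ut) => /eqP.
  have k11z : (m11 K)`_i.+1 = 0.
    have := congr1 (fun A : mat2 {poly F} => (m22 A)`_(n + i.+1)) NK.
    rewrite /= !coefD mul0r coef0 add0r coefCM (big _ sM22).
    rewrite mulr0 mulrN coefN (coef_mul_top sN21 k12).
    rewrite (coef_mul_top sN22 k11) k12z mulr0 oppr0 add0r => /eqP.
    by rewrite mulf_eq0 (negPf N22t) => /eqP.
  by split; apply: top.
have K1 : size_le K 1.
  have : size_le K (size (m11 K) + size (m12 K) + size (m21 K) + size (m22 K)).+1.
    split; move: (size (m11 K)) (size (m12 K)) (size (m21 K)) (size (m22 K)) => *;
      by clear; lia.
  by elim: (_ + _)%N => // i IH /red.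
have [k12z k21z] := off _ K1; have [k11 k12 k21 k22] := K1.
have cst (q : {poly F}) : (size q <= 1)%N -> q = (q.[0])%:P.
  by move=> /size1_polyC qE; rewrite {1}qE horner_coef0.
have K12 : m12 K = 0 by rewrite (cst _ k12) horner_coef0 k12z.
have K21 : m21 K = 0 by rewrite (cst _ k21) horner_coef0 k21z.
have [L1 L2] := lax_row0; have [N1 N2] := monodromy_0 n.
rewrite -LE in L1 L2; rewrite -NE in N1 N2.
have M'1 : (m11 M').[0] + (m21 M').[0] = 1.
  rewrite M'E /= !(hornerD, hornerM, hornerN) u0.
  transitivity (1 - t.[0] * ((m11 L).[0] + (m21 L).[0])); first ring.
  by rewrite L1 mulr0 subr0.
have M'2 : (m12 M').[0] + (m22 M').[0] = 1.
  rewrite M'E /= !(hornerD, hornerM, hornerN) u0.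
  transitivity (1 - t.[0] * ((m12 L).[0] + (m22 L).[0])); first ring.
  by rewrite L2 mulr0 subr0.
(* At [z = 0] the row [(1, 1)] is fixed by [M'] and by [N], hence by the constant diagonal matrix
   [K], which must be the identity. *)
have Kr1 : (m11 K).[0] + (m21 K).[0] = 1.
  transitivity (((m11 M').[0] + (m21 M').[0]) * (m11 N).[0] +
      ((m12 M').[0] + (m22 M').[0]) * (m21 N).[0]).
    by rewrite KE /= !(hornerD, hornerM); ring.
  by rewrite M'1 M'2 !mul1r -N1.
have Kr2 : (m12 K).[0] + (m22 K).[0] = 1.
  transitivity (((m11 M').[0] + (m21 M').[0]) * (m12 N).[0] +
      ((m12 M').[0] + (m22 M').[0]) * (m22 N).[0]).
    by rewrite KE /= !(hornerD, hornerM); ring.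
  by rewrite M'1 M'2 !mul1r -N2.
have K11 : m11 K = 1 by rewrite (cst _ k11); move: Kr1; rewrite K21 horner0 addr0 => ->.
have K22 : m22 K = 1 by rewrite (cst _ k22); move: Kr2; rewrite K12 horner0 add0r => ->.
have NM : N = M.
  have KI : K = mat2_scalar 1.
    by move: K11 K12 K21 K22; case: (K) => /= ? ? ? ? -> -> -> ->.
  by rewrite -MK KI -mat2_scalarC mat2_mul1.
have [xn _] := monodromy_x n; have [yn _] := monodromy_y n.
have [rx _] := lax_row_x; have [ry _] := lax_row_y; rewrite -LE in rx ry.
rewrite -NE NM ME /= !(hornerD, hornerM) ua in xn.
rewrite -NE NM ME /= !(hornerD, hornerM) ub in yn.
rewrite [p n]surjective_pairing [p 0]surjective_pairing xn yn; congr pair.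
  transitivity (x 0 + t.[a^-1] * (x 0 * (m11 L).[a^-1] + x 1 * (m21 L).[a^-1])).
    by ring.
  by rewrite rx mulr0 addr0.
transitivity (y 0 + t.[b^-1] * (y 0 * (m11 L).[b^-1] + y 1 * (m21 L).[b^-1])).
  by ring.
by rewrite ry mulr0 addr0.
Qed.

(** Closing makes [N] commute with [L], so [N] is [u + t L] over the rational functions; the point
    is that [t] is a polynomial. The entry [m12 L] has the single root [1 / mu], where [m11 L]
    squares to [P], which is nonzero there; commutation then makes [m12 N] vanish at this root. *)
Lemma periodic_pell n : let mu := a + b - x 1 ^+ 2 - y 1 ^+ 2 in
  (0 < n)%N -> p n = p 0 -> p n.+1 = p 1 -> mu != 0 -> P.[mu^-1] != 0 ->
  x 0 != 0 -> y 0 != 0 -> pell a b l n.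
Proof.
move=> mu n0 pn pn1 mu0 Pmu x00 y00.
have [N NE] : exists N, N = monodromy n by eexists.
have [L LE] : exists L, L = lax 0 by eexists.
have NL : mat2_mul N L = mat2_mul L N.
  have gn : g n = g 0 by rewrite -!hG pn pn1.
  have Ln : L = lax n by rewrite LE /lax gn /gram pn pn1.
  by rewrite {1}Ln NE monodromy_lax -LE.
have [LP L22] := lax_sqr; rewrite -LE in LP L22.
have L12E : m12 L = ((g 0 * rho)^-1 * mu)%:P * ('X - mu^-1%:P).
  have e : mu%:P * ('X - mu^-1%:P) = mu%:P * 'X - 1 by rewrite mulrBr -polyCM mulfV.
  by rewrite LE /= gram_diag -/mu -e mulrA -polyCM.
have cmu0 : (g 0 * rho)^-1 * mu != 0 by rewrite mulf_neq0 // invr_eq0 mulf_neq0.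
have L120 : m12 L != 0 by rewrite L12E mulf_neq0 ?polyC_eq0 ?polyXsubC_eq0.
have := congr1 (@m11 _) NL; have := congr1 (@m12 _) NL.
rewrite /= L22 => e12 e11.
have f12 : 2%:R * m11 L * m12 N = m12 L * (m11 N - m22 N).
  transitivity (m11 L * m12 N + m12 L * m22 N + m11 L * m12 N - m12 L * m22 N); first ring.
  by rewrite -e12; ring.
have f11 : m12 N * m21 L = m12 L * m21 N.
  by apply: (addrI (m11 N * m11 L)); rewrite e11; ring.
have /factor_theorem[t' t'E] : root (m12 N) mu^-1.
  have := congr1 (fun q : {poly F} => q.[mu^-1]) f12.
  rewrite L12E !hornerM hornerXsubC subrr mulr0 mul0r -polyC_natr hornerC => /eqP.
  rewrite !mulf_eq0 (negPf two) /= => /orP[|//] /eqP L11z.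
  case/eqP: Pmu.
  by rewrite -LP L12E hornerD !hornerM hornerXsubC subrr mulr0 mul0r addr0 L11z mul0r.
pose t := ((g 0 * rho)^-1 * mu)^-1%:P * t'.
have N12 : m12 N = t * m12 L.
  rewrite L12E t'E /t.
  transitivity (t' * ('X - mu^-1%:P) * (((g 0 * rho)^-1 * mu)^-1%:P * ((g 0 * rho)^-1 * mu)%:P)); last ring.
  by rewrite -polyCM mulVf // mulr1.
have N21 : m21 N = t * m21 L.
  by apply: (mulfI L120); rewrite -f11 N12; ring.
have ND : m11 N - m22 N = 2%:R * (t * m11 L).
  by apply: (mulfI L120); rewrite -f12 N12; ring.
pose u := 2%:R^-1%:P * (m11 N + m22 N).
have h2 : 2%:R^-1%:P * 2%:R = 1 :> {poly F} by rewrite -polyC_natr -polyCM mulVf.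
have N11 : m11 N = u + t * m11 L.
  transitivity (2%:R^-1%:P * 2%:R * m11 N); first by rewrite h2 mul1r.
  transitivity (u + 2%:R^-1%:P * (m11 N - m22 N)); first by rewrite /u; ring.
  by rewrite ND [_%:P * (2%:R * _)]mulrA h2 mul1r.
have N22 : m22 N = u - t * m11 L.
  transitivity (2%:R^-1%:P * 2%:R * m22 N); first by rewrite h2 mul1r.
  transitivity (u - 2%:R^-1%:P * (m11 N - m22 N)); first by rewrite /u; ring.
  by rewrite ND [_%:P * (2%:R * _)]mulrA h2 mul1r.
have uE : u = 2%:R^-1%:P * (m11 N + m22 N) by [].
clearbody t u.
have [L1 _] := lax_row0; have [N1 _] := monodromy_0 n; rewrite -NE in N1; rewrite -LE in L1.
have u0 : u.[0] = 1.
  rewrite N1 N11 N21 hornerD !hornerM.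
  transitivity (u.[0] + t.[0] * ((m11 L).[0] + (m21 L).[0])); last ring.
  by rewrite L1 mulr0 addr0.
have [d d0 dE] := monodromy_det n; rewrite -NE in dE.
have dE' : u ^+ 2 - t ^+ 2 * P = d%:P.
  by rewrite -dE /mat2_det N11 N22 N12 N21 -LP; ring.
have d1 : d = 1.
  have := congr1 (fun q : {poly F} => q.[0]) dE'; rewrite horner_norm u0 hornerC => <-.
  have -> : P.[0] = 0 by rewrite /pell_poly !hornerM hornerX !mul0r.
  by rewrite mulr0 subr0 expr1n.
exists u, t; split=> //; first by rewrite dE' d1.
(* As [u] is half the trace of [N], its coefficient of degree [n] comes from the lower right entry
   alone. *)
- have [sN11 _ _ sN22] := monodromy_size n; rewrite -NE in sN11 sN22.
  have [N11t _] := monodromy_top n.-1; have [_ N22t] := monodromy_top n.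
  rewrite prednK // -NE in N11t; rewrite -NE in N22t.
  have un : u`_n != 0.
    by rewrite uE coefCM coefD N11t add0r mulf_neq0 // invr_eq0.
  apply/eqP; rewrite eqn_leq; apply/andP; split.
    rewrite uE mul_polyC; apply: leq_trans (size_scale_leq _ _) _.
    exact: size_add_le.
  by rewrite ltnNge; apply: contra un => /leq_sizeP ->.
- have [xn _] := monodromy_x n; have [rx _] := lax_row_x; rewrite -LE in rx.
  apply: (mulfI x00); rewrite mulr1 -[RHS](congr1 fst pn) xn -NE N11 N21 hornerD !hornerM.
  transitivity (x 0 * u.[a^-1] + t.[a^-1] * (x 0 * (m11 L).[a^-1] + x 1 * (m21 L).[a^-1])).
    by rewrite rx mulr0 addr0.
  by ring.
have [yn _] := monodromy_y n; have [ry _] := lax_row_y; rewrite -LE in ry.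
apply: (mulfI y00); rewrite mulr1 -[RHS](congr1 snd pn) yn -NE N11 N21 hornerD !hornerM.
transitivity (y 0 * u.[b^-1] + t.[b^-1] * (y 0 * (m11 L).[b^-1] + y 1 * (m21 L).[b^-1])).
  by rewrite ry mulr0 addr0.
by ring.
Qed.

End Chain.

(** * Billiard reflections *)

Section Reflection.
Variables (R : realType) (a b : R).
Hypotheses (hb : 0 < b) (hab : b < a).
Implicit Types u v w p q r : R * R.

Let ha : 0 < a. Proof. exact: lt_trans hab. Qed.
Let a0 : a != 0. Proof. exact: lt0r_neq0. Qed.
Let b0 : b != 0. Proof. exact: lt0r_neq0. Qed.

(** For two points of the ellipse this is the pairing of the chord [q - p] with [normal q], and half
    the squared length of the chord for the form of the ellipse; hence it is positive when they
    differ. *)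
Definition gap p q : R := 1 - (p.1 * q.1 / a + p.2 * q.2 / b).
Definition normal q : R * R := (q.1 / a, q.2 / b).

Lemma on_ellipseE p : on_ellipse a b p <-> p.1 ^+ 2 / a + p.2 ^+ 2 / b = 1.
Proof. by rewrite /on_ellipse /on_conic !subr0 expr1n. Qed.

Lemma dot_gt0 u : (0 < dot u u) = (u != 0).
Proof.
case: u => u1 u2; rewrite /dot /= lt_neqAle eq_sym -!expr2 addr_ge0 ?sqr_ge0 // andbT.
by rewrite paddr_eq0 ?sqr_ge0 // !sqrf_eq0.
Qed.

Lemma enorm_sqr u : enorm u ^+ 2 = dot u u.
Proof. by rewrite sqr_sqrtr // /dot -!expr2 addr_ge0 ?sqr_ge0. Qed.

Lemma enorm_gt0 u : u != 0 -> 0 < enorm u.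
Proof. by move=> u0; rewrite sqrtr_gt0 dot_gt0. Qed.

Lemma dot_tangent_normal q u :
  dot u (normal q) ^+ 2 + dot u (tangent_dir a b q) ^+ 2 =
  dot (normal q) (normal q) * dot u u.
Proof. by rewrite /dot /=; ring. Qed.

Lemma tangent_dir_neq0 q : on_ellipse a b q -> tangent_dir a b q != 0.
Proof.
move=> /on_ellipseE e; apply: contra_eq_neq e => /eqP; rewrite xpair_eqE oppr_eq0.
rewrite !mulf_eq0 !invr_eq0 (negPf a0) (negPf b0) !orbF => /andP[/eqP -> /eqP ->].
by rewrite expr0n !mul0r addr0 eq_sym oner_neq0.
Qed.

Lemma normal_gt0 q : on_ellipse a b q -> 0 < dot (normal q) (normal q).
Proof.
move=> /tangent_dir_neq0; rewrite -dot_gt0; congr (0 < _).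
by rewrite /dot /=; ring.
Qed.

Lemma cos_bound u v : u != 0 -> v != 0 ->
  -1 <= dot u v / (enorm u * enorm v) <= 1.
Proof.
move=> u0 v0; have n0 : 0 < enorm u * enorm v by rewrite mulr_gt0 ?enorm_gt0.
rewrite -ler_norml normrM normfV (gtr0_norm n0) ler_pdivrMr // mul1r.
rewrite -(@ler_pXn2r _ 2) ?nnegrE ?normr_ge0 ?(ltW n0) //.
rewrite real_normK ?num_real // exprMn !enorm_sqr -subr_ge0.
have -> : dot u u * dot v v - dot u v ^+ 2 = (u.1 * v.2 - u.2 * v.1) ^+ 2.
  by rewrite /dot; ring.
exact: sqr_ge0.
Qed.

Lemma angle_eqP u v t : u != 0 -> v != 0 -> t != 0 ->
  angle u t = angle v t <-> dot u t * enorm v = dot v t * enorm u.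
Proof.
move=> u0 v0 t0; have [u1 v1 t1] := And3 (enorm_gt0 u0) (enorm_gt0 v0) (enorm_gt0 t0).
have nz := (lt0r_neq0 u1, lt0r_neq0 v1, lt0r_neq0 t1).
split=> [/(congr1 (@cos R))|e].
  rewrite !acosK ?in_itv /= ?cos_bound // => e.
  transitivity (dot u t / (enorm u * enorm t) * (enorm u * enorm v * enorm t)).
    by field; rewrite !nz.
  by rewrite e; field; rewrite !nz.
congr acos; transitivity (dot u t * enorm v / (enorm u * enorm v * enorm t)).
  by field; rewrite !nz.
by rewrite e; field; rewrite !nz.
Qed.

Lemma gap_half p q : on_ellipse a b p -> on_ellipse a b q ->
  gap p q = ((q.1 - p.1) ^+ 2 / a + (q.2 - p.2) ^+ 2 / b) / 2%:R.
Proof.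
move=> /on_ellipseE ep /on_ellipseE eq.
transitivity ((p.1 ^+ 2 / a + p.2 ^+ 2 / b + (q.1 ^+ 2 / a + q.2 ^+ 2 / b)
   - 2%:R * (p.1 * q.1 / a + p.2 * q.2 / b)) / 2%:R).
  by rewrite ep eq /gap; field; rewrite a0 b0.
by field; rewrite a0 b0.
Qed.

Lemma conf_norm_gt0 u : u != 0 -> 0 < u.1 ^+ 2 / a + u.2 ^+ 2 / b.
Proof.
case: u => u1 u2; rewrite xpair_eqE /= => u0.
have t1 : 0 <= u1 ^+ 2 / a by rewrite mulr_ge0 ?sqr_ge0 // invr_ge0 ltW.
have t2 : 0 <= u2 ^+ 2 / b by rewrite mulr_ge0 ?sqr_ge0 // invr_ge0 ltW.
rewrite lt_neqAle addr_ge0 // andbT eq_sym paddr_eq0 //.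
have e (u c : R) : c != 0 -> (u ^+ 2 / c == 0) = (u == 0).
  by move=> c0; rewrite mulf_eq0 sqrf_eq0 invr_eq0 (negPf c0) orbF.
by rewrite !e.
Qed.

Lemma gap_gt0 p q : on_ellipse a b p -> on_ellipse a b q -> p <> q -> 0 < gap p q.
Proof.
move=> ep eq /eqP pq; rewrite gap_half // divr_gt0 ?ltr0n //.
have := @conf_norm_gt0 (q - p); apply.
by rewrite subr_eq0 eq_sym.
Qed.

(** The last two equations read [r - q = s (q - p) + m (normal q)]: [s] is the ratio of the chord
    lengths, and [m] reverses the normal component of the scaled chord. *)
Definition bounce p q r (s m : R) : Prop :=
  [/\ 0 < s, m * dot (normal q) (normal q) = - 2%:R * s * gap p q,
      r.1 = - s * p.1 + (1 + s) * q.1 + m * (q.1 / a) &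
      r.2 = - s * p.2 + (1 + s) * q.2 + m * (q.2 / b)].

(** Equal angles make the tangential components proportional to the lengths, which determines the
    normal component up to sign; positivity of the two gaps selects the sign. *)
Lemma reflection_bounce p q r : on_ellipse a b p -> on_ellipse a b q ->
  on_ellipse a b r -> p <> q -> q <> r -> reflection_law a b p q r ->
  exists s m, bounce p q r s m.
Proof.
move=> ep eq er pq qr.
have v0 : q - p != 0 by rewrite subr_eq0 eq_sym; apply/eqP.
have w0 : r - q != 0 by rewrite subr_eq0 eq_sym; apply/eqP.
have t0 := tangent_dir_neq0 eq; have N0 := normal_gt0 eq.
move=> /(angle_eqP v0 w0 t0) law.
have [nv nw] := (enorm_gt0 v0, enorm_gt0 w0).
pose s := enorm (r - q) / enorm (q - p).
have s0 : 0 < s by rewrite divr_gt0.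
have wt : dot (r - q) (tangent_dir a b q) = s * dot (q - p) (tangent_dir a b q).
  apply: (mulIf (lt0r_neq0 nv)); rewrite -law /s; field.
  exact: lt0r_neq0.
have ww : dot (r - q) (r - q) = s ^+ 2 * dot (q - p) (q - p).
  by rewrite -!enorm_sqr /s; field; exact: lt0r_neq0.
have /on_ellipseE eq' := eq.
have vn : dot (q - p) (normal q) = gap p q.
  by rewrite /gap -eq' /dot /=; field; rewrite a0 b0.
have wn : dot (r - q) (normal q) = - gap q r.
  by rewrite /gap -eq' /dot /=; field; rewrite a0 b0.
have g1 := gap_gt0 ep eq pq; have g2 := gap_gt0 eq er qr.
have gs : gap q r = s * gap p q.
  apply/eqP; rewrite -(eqrXn2 (n := 2)) //; [|exact: ltW|by rewrite mulr_ge0 // ltW].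
  apply/eqP; have := dot_tangent_normal q (r - q).
  rewrite wn wt ww sqrrN => e.
  transitivity (dot (normal q) (normal q) * (s ^+ 2 * dot (q - p) (q - p)) -
     (s * dot (q - p) (tangent_dir a b q)) ^+ 2); first by rewrite -e; ring.
  transitivity (s ^+ 2 * (dot (normal q) (normal q) * dot (q - p) (q - p) -
     dot (q - p) (tangent_dir a b q) ^+ 2)); first by ring.
  by rewrite -dot_tangent_normal vn; ring.
pose m := - 2%:R * s * gap p q / dot (normal q) (normal q).
have mN : m * dot (normal q) (normal q) = - 2%:R * s * gap p q.
  by rewrite /m divfK // lt0r_neq0.
have N1 := lt0r_neq0 N0.
exists s, m; split=> //.
  apply/eqP; rewrite -subr_eq0; apply/eqP; apply: (mulfI N1); rewrite mulr0.
  transitivity ((q.1 / a) * (dot (r - q) (normal q) - s * dot (q - p) (normal q)) -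
    (q.2 / b) * (dot (r - q) (tangent_dir a b q) - s * dot (q - p) (tangent_dir a b q)) -
    m * dot (normal q) (normal q) * (q.1 / a)); first by rewrite /dot /=; ring.
  by rewrite wn vn wt gs mN; ring.
apply/eqP; rewrite -subr_eq0; apply/eqP; apply: (mulfI N1); rewrite mulr0.
transitivity ((q.2 / b) * (dot (r - q) (normal q) - s * dot (q - p) (normal q)) +
  (q.1 / a) * (dot (r - q) (tangent_dir a b q) - s * dot (q - p) (tangent_dir a b q)) -
  m * dot (normal q) (normal q) * (q.2 / b)); first by rewrite /dot /=; ring.
by rewrite wn vn wt gs mN; ring.
Qed.

(** Gap and chord length are both multiplied by [s]. Their ratio is thus conserved: this is the
    Joachimsthal integral, which by [tangent_gap] determines the caustic. *)
Lemma bounce_invariants p q r s m : on_ellipse a b q -> bounce p q r s m ->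
  gap q r = s * gap p q /\ dot (r - q) (r - q) = s ^+ 2 * dot (q - p) (q - p).
Proof.
move=> /on_ellipseE eq [s0 mN rE1 rE2].
split.
  transitivity (1 + s - (1 + s) * (q.1 ^+ 2 / a + q.2 ^+ 2 / b) - s * gap p q -
     m * dot (normal q) (normal q)).
    by rewrite {1}/gap rE1 rE2 /gap /dot /=; field; rewrite a0 b0.
  by rewrite eq mN; ring.
transitivity (s ^+ 2 * dot (q - p) (q - p) + m * (2%:R * s * ((q.1 ^+ 2 / a + q.2 ^+ 2 / b) - 1 + gap p q) +
    m * dot (normal q) (normal q))).
  by rewrite /dot /gap /= rE1 rE2; field; rewrite a0 b0.
by rewrite eq mN; ring.
Qed.

Lemma bounce_exists p q : on_ellipse a b p -> on_ellipse a b q -> p <> q ->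
  exists r, [/\ on_ellipse a b r, q <> r, reflection_law a b p q r &
    exists s m, bounce p q r s m].
Proof.
move=> ep eq pq; have g0 := gap_gt0 ep eq pq; have N0 := normal_gt0 eq.
have N1 := lt0r_neq0 N0.
have v0 : q - p != 0 by rewrite subr_eq0 eq_sym; apply/eqP.
have /on_ellipseE eq' := eq.
(* With this [k], the vector [v'] below is the mirror image of [q - p] in the tangent at [q]. *)
pose k := 2%:R * gap p q / dot (normal q) (normal q).
have kN : k * dot (normal q) (normal q) = 2%:R * gap p q by rewrite /k divfK.
clearbody k.
pose v' : R * R := (q.1 - p.1 - k * (q.1 / a), q.2 - p.2 - k * (q.2 / b)).
have vv : dot v' v' = dot (q - p) (q - p).
  transitivity (dot (q - p) (q - p) + k * (k * dot (normal q) (normal q) -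
     2%:R * (q.1 ^+ 2 / a + q.2 ^+ 2 / b - 1 + gap p q))).
    by rewrite /dot /gap /=; field; rewrite a0 b0.
  by rewrite kN eq'; ring.
have v'0 : v' != 0 by rewrite -dot_gt0 vv dot_gt0.
have c0 := conf_norm_gt0 v'0.
(* The equation of the ellipse along [q + s v'] is quadratic in [s] with root 0; this is the other
   root. *)
pose s := 2%:R * gap p q / (v'.1 ^+ 2 / a + v'.2 ^+ 2 / b).
have sc : s * (v'.1 ^+ 2 / a + v'.2 ^+ 2 / b) = 2%:R * gap p q.
  by rewrite /s divfK // lt0r_neq0.
have s0 : 0 < s by rewrite divr_gt0 // mulr_gt0 ?ltr0n.
clearbody s.
pose r : R * R := (q.1 + s * v'.1, q.2 + s * v'.2).
have rq : r - q = (s * v'.1, s * v'.2).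
  by congr pair; rewrite /= addrC addKr.
have w0 : r - q != 0.
  rewrite -dot_gt0 rq.
  have -> : dot (s * v'.1, s * v'.2) (s * v'.1, s * v'.2) = s ^+ 2 * dot v' v'.
    by rewrite /dot /=; ring.
  by rewrite mulr_gt0 ?exprn_gt0 // dot_gt0.
have B : bounce p q r s (- s * k).
  split=> //.
  - by transitivity (- s * (k * dot (normal q) (normal q))); [ring | rewrite kN; ring].
  - by rewrite /=; ring.
  by rewrite /=; ring.
exists r; split.
- apply/on_ellipseE.
  transitivity (q.1 ^+ 2 / a + q.2 ^+ 2 / b + s * (2%:R * ((q.1 ^+ 2 / a + q.2 ^+ 2 / b) - 1 + gap p q
     - k * dot (normal q) (normal q)) + s * (v'.1 ^+ 2 / a + v'.2 ^+ 2 / b))).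
    by rewrite /r /v' /gap /dot /=; field; rewrite a0 b0.
  by rewrite eq' sc kN; ring.
- by move=> qr; move: w0; rewrite -qr subrr eqxx.
- apply/(angle_eqP v0 w0 (tangent_dir_neq0 eq)).
  have -> : enorm (r - q) = s * enorm (q - p).
    rewrite /enorm -vv rq.
    have -> : dot (s * v'.1, s * v'.2) (s * v'.1, s * v'.2) = s ^+ 2 * dot v' v'.
      by rewrite /dot /=; ring.
    by rewrite sqrtrM ?sqr_ge0 // sqrtr_sqr gtr0_norm.
  rewrite rq mulrA; congr (_ * _).
  by rewrite /dot /v' /=; ring.
by exists s, (- s * k).
Qed.

(** The right side is the equation of the dual conic: the line [A x + B y = C] is tangent when
    [A ^ 2 (a - l) + B ^ 2 (b - l) = C ^ 2]. *)
Lemma tangentE l p q : a - l != 0 -> b - l != 0 -> p <> q ->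
  tangent_to_conic a b l p q <->
  (p.1 * q.2 - p.2 * q.1) ^+ 2 =
    (q.1 - p.1) ^+ 2 * (b - l) + (q.2 - p.2) ^+ 2 * (a - l).
Proof.
move=> al bl pq; split=> [[x [y [z [xyz con tp tq]]]]|h].
  have d : x / (a - l) * (q.1 - p.1) + y / (b - l) * (q.2 - p.2) = 0.
    by transitivity (z - z); [rewrite -{1}tq -tp; ring|rewrite subrr].
  (* The gradient of the conic at the contact point is orthogonal to the chord, hence a multiple of
     the chord turned by a right angle. *)
  have [t [xE yE]] : exists t, x / (a - l) = t * (q.2 - p.2) /\
      y / (b - l) = - (t * (q.1 - p.1)).
    have [v1|v1] := eqVneq (q.1 - p.1) 0; last first.
      exists (- (y / (b - l)) / (q.1 - p.1)); split.
        apply: (mulIf v1); apply: (addIr (y / (b - l) * (q.2 - p.2))).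
        by rewrite d; move: v1; move: (q.1 - p.1) => v v1; field; rewrite v1 bl.
      by rewrite divfK // opprK.
    have v2 : q.2 - p.2 != 0.
      apply: contra_notN pq => v2; move/eqP: v1; rewrite subr_eq0 => /eqP v1.
      by rewrite [p]surjective_pairing [q]surjective_pairing v1; congr pair; apply/eqP; rewrite eq_sym -subr_eq0.
    exists (x / (a - l) / (q.2 - p.2)); rewrite divfK //; split=> //.
    move: d; rewrite v1 !mulr0 add0r oppr0 => /eqP.
    by rewrite mulf_eq0 (negPf v2) orbF => /eqP.
  have xE' : x = t * (q.2 - p.2) * (a - l) by rewrite -xE divfK.
  have yE' : y = - (t * (q.1 - p.1)) * (b - l) by rewrite -yE divfK.
  have zE : z = t * (p.1 * q.2 - p.2 * q.1).
    rewrite -tp mulrAC xE [y * _ / _]mulrAC yE; ring.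
  have t0 : t ^+ 2 != 0.
    rewrite sqrf_eq0; apply: contra_notN xyz => /eqP t0.
    by rewrite xE' yE' zE t0 !mul0r oppr0 mul0r.
  apply: (mulfI t0).
  transitivity (z ^+ 2); first by rewrite zE; ring.
  by rewrite -con xE' yE'; field; rewrite al bl.
exists ((q.2 - p.2) * (a - l)), (- (q.1 - p.1) * (b - l)), (p.1 * q.2 - p.2 * q.1).
split.
- move=> [/eqP + /eqP + _]; rewrite !mulf_eq0 oppr_eq0 (negPf al) (negPf bl) !orbF.
  rewrite !subr_eq0 => /eqP e2 /eqP e1; apply: pq.
  by rewrite [p]surjective_pairing [q]surjective_pairing e1 e2.
- by rewrite /on_conic h; field; rewrite al bl.
- by field; rewrite al bl.
by field; rewrite al bl.
Qed.

Lemma cross_sqr p q : on_ellipse a b p -> on_ellipse a b q ->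
  (p.1 * q.2 - p.2 * q.1) ^+ 2 = b * (q.1 - p.1) ^+ 2 + a * (q.2 - p.2) ^+ 2 -
    a * b * gap p q ^+ 2.
Proof.
move=> /on_ellipseE ep /on_ellipseE eq.
transitivity (a * b * ((p.1 ^+ 2 / a + p.2 ^+ 2 / b) * (q.1 ^+ 2 / a + q.2 ^+ 2 / b) -
   (1 - gap p q) ^+ 2)); first by rewrite /gap; field; rewrite a0 b0.
rewrite ep eq.
transitivity (a * b * ((p.1 ^+ 2 / a + p.2 ^+ 2 / b) + (q.1 ^+ 2 / a + q.2 ^+ 2 / b)
   - 2%:R * (1 - gap p q)) - a * b * gap p q ^+ 2).
  by rewrite ep eq; ring.
by rewrite /gap; field; rewrite a0 b0.
Qed.

Lemma tangent_gap l p q : a - l != 0 -> b - l != 0 ->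
  on_ellipse a b p -> on_ellipse a b q -> p <> q ->
  tangent_to_conic a b l p q <-> l * dot (q - p) (q - p) = a * b * gap p q ^+ 2.
Proof.
move=> al bl ep eq pq; apply: (iff_trans (tangentE al bl pq)); rewrite cross_sqr //.
have e : b * (q.1 - p.1) ^+ 2 + a * (q.2 - p.2) ^+ 2 - l * dot (q - p) (q - p) =
    (q.1 - p.1) ^+ 2 * (b - l) + (q.2 - p.2) ^+ 2 * (a - l) by rewrite /dot /=; ring.
by rewrite -e; split=> [/addrI/oppr_inj -> //|->].
Qed.

End Reflection.

(** * Real trajectories with a given caustic *)

Section Trajectories.
Variables (R : realType) (a b l : R).
Hypotheses (hb : 0 < b) (hab : b < a) (hl : 0 < l) (hla : l < a) (hlb : l != b).

Let ha : 0 < a. Proof. exact: lt_trans hab. Qed.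
Let a0 : a != 0. Proof. exact: lt0r_neq0. Qed.
Let b0 : b != 0. Proof. exact: lt0r_neq0. Qed.
Let l0 : l != 0. Proof. exact: lt0r_neq0. Qed.
Let al : a - l != 0. Proof. by rewrite subr_eq0 gt_eqF. Qed.
Let bl : b - l != 0. Proof. by rewrite subr_eq0 eq_sym. Qed.

Lemma trajectory_pell (C : closedFieldType) (f : {rmorphism R -> C})
    (p : nat -> R * R) (n : nat) :
    billiard_trajectory a b p -> has_caustic a b l p -> (0 < n)%N ->
  (pell (f a) (f b) (f l) n -> p n = p 0%N) /\
  (p n = p 0%N -> p n.+1 = p 1%N ->
   let mu := a + b - (p 1%N).1 ^+ 2 - (p 1%N).2 ^+ 2 in
   [/\ mu != 0, mu != a, mu != b & mu != l] ->
   (p 0%N).1 != 0 -> (p 0%N).2 != 0 -> pell (f a) (f b) (f l) n).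
Proof.
move=> [pE pne plaw] pcau n0.
pose g k := gap a b (p k) (p k.+1).
have g_gt0 k : 0 < g k by apply: gap_gt0.
(* Each bounce supplies its own [s] and [m]. Recovering them by closed formulas from the gaps and
   normals turns them into sequences. *)
pose s k := g k.+1 / g k.
pose m k := - 2%:R * s k * g k / dot (normal a b (p k.+1)) (normal a b (p k.+1)).
have B k : bounce a b (p k) (p k.+1) (p k.+2) (s k) (m k).
  have [s1 [m1 B1]] := reflection_bounce hb hab (pE k) (pE k.+1) (pE k.+2) (pne k) (pne k.+1) (plaw k).
  have [gs _] := bounce_invariants hb hab (pE k.+1) B1.
  have sE : s k = s1 by rewrite /s /g gs mulfK //; exact/lt0r_neq0/g_gt0.
  have [_ mN _ _] := B1.
  have -> : m k = m1.
    by rewrite /m sE -mN mulfK //; exact/lt0r_neq0/(normal_gt0 hb hab (pE k.+1)).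
  by rewrite sE.
clearbody s m.
have rho2 : 0 < a * b / l by rewrite divr_gt0 ?mulr_gt0.
pose rho := Num.sqrt (a * b / l).
have rhoE : rho ^+ 2 = a * b / l by rewrite sqr_sqrtr // ltW.
have rho0 : rho != 0 by rewrite lt0r_neq0 // sqrtr_gt0.
have tg := (tangent_gap hb hab al bl (pE 0%N) (pE 1%N) (pne 0%N)).1 (pcau 0%N).
have W := (tangentE al bl (pne 0%N)).1 (pcau 0%N).
pose p' k := (f (p k).1, f (p k).2).
pose g' k := f (g k); pose s' k := f (s k); pose m' k := f (m k).
have fnz z : z != 0 -> f z != 0 by rewrite fmorph_eq0.
have f2 : (2%:R : C) != 0 by rewrite -(rmorph_nat f) fnz // pnatr_eq0.
have fa0 := fnz _ a0; have fb0 := fnz _ b0; have fl0 := fnz _ l0.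
have frho0 := fnz _ rho0.
have frho : f rho ^+ 2 = f a * f b / f l by rewrite -rmorphXn rhoE fmorph_div rmorphM.
have fE k : (p' k).1 ^+ 2 / f a + (p' k).2 ^+ 2 / f b = 1.
  have /on_ellipseE/(congr1 f) := pE k.
  by rewrite rmorphD !fmorph_div !rmorphXn rmorph1.
have fG k : 1 - ((p' k).1 * (p' k.+1).1 / f a + (p' k).2 * (p' k.+1).2 / f b) = g' k.
  by rewrite /g' /g /gap rmorphB rmorphD !fmorph_div !rmorphM rmorph1.
have fg0 k : g' k != 0 by apply/fnz/lt0r_neq0/g_gt0.
have fs0 k : s' k != 0 by have [s0 _ _ _] := B k; apply/fnz/lt0r_neq0.
have fm0 k : m' k != 0.
  have [s0 mN _ _] := B k; apply: fnz; apply: contra_eq_neq mN => ->.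
  rewrite mul0r eq_sym; apply: mulf_neq0; last exact/lt0r_neq0/g_gt0.
  by apply: mulf_neq0; [rewrite oppr_eq0 pnatr_eq0 | exact: lt0r_neq0].
have fx k : (p' k.+2).1 = - s' k * (p' k).1 + (1 + s' k) * (p' k.+1).1 +
    m' k * ((p' k.+1).1 / f a).
  have [_ _ rx _] := B k; rewrite /= rx.
  by rewrite /s' /m' !(rmorphD, rmorphM, rmorphN, rmorph1, fmorphV).
have fy k : (p' k.+2).2 = - s' k * (p' k).2 + (1 + s' k) * (p' k.+1).2 +
    m' k * ((p' k.+1).2 / f b).
  have [_ _ _ ry] := B k; rewrite /= ry.
  by rewrite /s' /m' !(rmorphD, rmorphM, rmorphN, rmorph1, fmorphV).
have fm k : m' k * (((p' k.+1).1 / f a) ^+ 2 + ((p' k.+1).2 / f b) ^+ 2) =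
    - 2%:R * s' k * g' k.
  have [_ /(congr1 f) mN _ _] := B k; move: mN; rewrite /dot /= -!expr2.
  rewrite rmorphM rmorphD !rmorphXn !fmorph_div => ->.
  by rewrite /s' /g' !(rmorphM, rmorphN, rmorph_nat).
have fW : ((p' 0%N).1 * (p' 1%N).2 - (p' 0%N).2 * (p' 1%N).1) ^+ 2 =
    ((p' 1%N).1 - (p' 0%N).1) ^+ 2 * (f b - f l) +
    ((p' 1%N).2 - (p' 0%N).2) ^+ 2 * (f a - f l).
  have := congr1 f W.
  by rewrite !(rmorphXn, rmorphB, rmorphD, rmorphM).
have fV : ((p' 1%N).1 - (p' 0%N).1) ^+ 2 + ((p' 1%N).2 - (p' 0%N).2) ^+ 2 =
    f rho ^+ 2 * g' 0%N ^+ 2.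
  have V : dot (p 1%N - p 0%N) (p 1%N - p 0%N) = rho ^+ 2 * g 0%N ^+ 2.
    by rewrite rhoE; apply: (mulfI l0); rewrite tg /g; field.
  have := congr1 f V; rewrite /dot /= -!expr2.
  by rewrite /g' !(rmorphXn, rmorphB, rmorphD, rmorphM).
have inj i j : p' i = p' j -> p i = p j.
  move=> [/fmorph_inj h1 /fmorph_inj h2].
  by rewrite [p i]surjective_pairing h1 h2 -surjective_pairing.
split=> [[u [t [E su u0 ua ub]]]|pn pn1 mu [mu0 mua mub mul] x0 y0].
  apply: inj.
  by eapply (@pell_periodic C (f a) (f b) (f l) (f rho) p' s' m' g'); eassumption.
have muE : f a + f b - (p' 1%N).1 ^+ 2 - (p' 1%N).2 ^+ 2 = f mu.
  by rewrite /mu !rmorphB rmorphD !rmorphXn.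
have fmu : f mu != 0 by exact: fnz.
have Pmu : (pell_poly (f a) (f b) (f l)).[(f mu)^-1] != 0.
  rewrite pell_at ?invr_eq0 // invrK -!rmorphB !mulf_neq0 ?expf_neq0 ?invr_eq0 ?fnz //.
  - by rewrite subr_eq0 eq_sym.
  - by rewrite subr_eq0 eq_sym.
  by rewrite subr_eq0 eq_sym.
apply: (@periodic_pell C (f a) (f b) (f l) (f rho) p' s' m' g') => //.
- by rewrite /p' pn.
- by rewrite /p' pn1.
- by rewrite muE.
- by rewrite muE.
- exact: fnz.
exact: fnz.
Qed.

Lemma trajectory_exists (p0 p1 : R * R) :
    on_ellipse a b p0 -> on_ellipse a b p1 -> p0 <> p1 ->
    tangent_to_conic a b l p0 p1 ->
  exists p : nat -> R * R, [/\ p 0%N = p0, p 1%N = p1,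
    billiard_trajectory a b p & has_caustic a b l p].
Proof.
move=> e0 e1 ne tan.
(* The state is a pair of consecutive vertices. The hypotheses guard the relation, so that it is
   total and a successor function can be chosen. *)
pose P (x : (R * R) * (R * R)) r := on_ellipse a b x.1 -> on_ellipse a b x.2 ->
  x.1 <> x.2 -> [/\ on_ellipse a b r, x.2 <> r, reflection_law a b x.1 x.2 r &
    exists s m, bounce a b x.1 x.2 r s m].
have [next nextP] : {next & forall x, P x (next x)}.
  apply: choice => x; have [h|h] := pselect (exists r, P x r); first exact: h.
  exists (0, 0) => ex ey xy; case: h.
  by have [r hr] := bounce_exists hb hab ex ey xy; exists r.
pose st k := iter k (fun x => (x.2, next x)) (p0, p1).
have inv k : [/\ on_ellipse a b (st k).1, on_ellipse a b (st k).2,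
    (st k).1 <> (st k).2 & tangent_to_conic a b l (st k).1 (st k).2].
  elim: k => [//|k [i1 i2 i3 i4]] /=.
  have [r1 r2 r3 [s [m B]]] := nextP (st k) i1 i2 i3.
  split=> //; apply/(tangent_gap hb hab al bl i2 r1 r2).
  have [gE dE] := bounce_invariants hb hab i2 B.
  have := (tangent_gap hb hab al bl i1 i2 i3).1 i4.
  rewrite gE dE => h; transitivity (s ^+ 2 * (l * dot ((st k).2 - (st k).1) ((st k).2 - (st k).1))).
    by ring.
  by rewrite h; ring.
exists (fun k => (st k).1); split=> // [|k].
  split=> k; have [i1 i2 i3 _] := inv k => //.
  by have [] := nextP (st k) i1 i2 i3.
by have [] := inv k.
Qed.

(** The vertical tangent of the caustic at [(sqrt (a - l), 0)], which exists for ellipses and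
    hyperbolas alike. Here [mu = b + l - b l / a], and its differences with [a], [b] and [l] factor
    explicitly, which shows that [mu] avoids the branch points. *)
Lemma symmetric_chord : exists p0 p1 : R * R,
  [/\ on_ellipse a b p0, on_ellipse a b p1, p0 <> p1, tangent_to_conic a b l p0 p1 &
   let mu := a + b - p1.1 ^+ 2 - p1.2 ^+ 2 in
   [/\ mu != 0, mu != a, mu != b & mu != l] /\ p0.1 != 0 /\ p0.2 != 0].
Proof.
pose xi := Num.sqrt (a - l); pose eta := Num.sqrt (b * l / a).
have al0 : 0 < a - l by rewrite subr_gt0.
have bl0 : 0 < b * l / a by rewrite divr_gt0 ?mulr_gt0.
have xi2 : xi ^+ 2 = a - l by rewrite sqr_sqrtr // ltW.
have eta2 : eta ^+ 2 = b * l / a by rewrite sqr_sqrtr // ltW.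
have xi0 : 0 < xi by rewrite sqrtr_gt0.
have eta0 : 0 < eta by rewrite sqrtr_gt0.
have E : xi ^+ 2 / a + eta ^+ 2 / b = 1 by rewrite xi2 eta2; field; rewrite a0 b0.
have ne : (xi, - eta) <> (xi, eta).
  case=> /eqP; rewrite -subr_eq0 -opprD oppr_eq0 -mulr2n mulrn_eq0 /=.
  by rewrite (negPf (lt0r_neq0 eta0)).
exists (xi, - eta), (xi, eta); split=> //.
- by apply/on_ellipseE; rewrite /= sqrrN.
- by apply/on_ellipseE.
- by apply/(tangentE al bl ne); rewrite /= -xi2; ring.
have [n1 n2] := (lt0r_neq0 xi0, lt0r_neq0 eta0).
rewrite /= xi2 eta2 oppr_eq0; split; last by rewrite n1 n2.
have -> : a + b - (a - l) - b * l / a = b + l - b * l / a by ring.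
have nz (u v w : R) : u = v / a -> v != 0 -> u != 0.
  by move=> -> v0; rewrite mulf_neq0 // invr_eq0.
have ab0 : a - b != 0 by rewrite subr_eq0 gt_eqF.
split.
- apply: (nz _ (b * a + l * (a - b)) 0); first by field.
  by rewrite lt0r_neq0 // addr_gt0 ?mulr_gt0 // subr_gt0.
- rewrite -subr_eq0.
  by apply: (nz _ (- ((a - b) * (a - l))) 0); [field|rewrite oppr_eq0 mulf_neq0].
- rewrite -subr_eq0.
  by apply: (nz _ (l * (a - b)) 0); [field|rewrite mulf_neq0].
rewrite -subr_eq0.
by apply: (nz _ (b * (a - l)) 0); [field|rewrite mulf_neq0].
Qed.

End Trajectories.

(** * Conclusion over the complex numbers *)

Local Open Scope complex_scope.

Theorem theorem2p2 (R : realType) (a b l0 : R) (n : nat)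
  (hb : 0 < b) (hab : b < a)
  (hl0 : 0 < l0 < b \/ b < l0 < a)
  (hn : (0 < n)%N)
  (Q0 Ql0 : curve (a%:C : R[i]) b%:C l0%:C)
  (hQ0 : abscissa Q0 = Some 0)
  (hQl0 : abscissa Ql0 = Some l0%:C) :
  (forall p : nat -> R * R,
     billiard_trajectory a b p -> has_caustic a b l0 p -> n_periodic n p)
  <-> lin_equiv (point_div Q0 *+ n) (point_div Ql0 *+ n).
Proof.
have [hl hla hlb] : [/\ 0 < l0, l0 < a & l0 != b].
  case: hl0 => /andP[h1 h2]; split=> //.
  - exact: lt_trans hab.
  - by rewrite lt_eqF.
  - exact: lt_trans h1.
  by rewrite gt_eqF.
have ha := lt_trans hb hab.
pose f : {rmorphism R -> R[i]} := real_complex R.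
have fE (z w : R) : z != w -> z%:C != w%:C by rewrite (inj_eq (@complexI R)).
have f0 (z : R) : 0 < z -> z%:C != 0 by move=> z0; apply: (fE z 0); rewrite gt_eqF.
have two : (2%:R : R[i]) != 0 by rewrite pnatr_eq0.
have ab : a%:C != b%:C by apply: fE; rewrite gt_eqF.
have al : a%:C != l0%:C by apply: fE; rewrite gt_eqF.
have bl : b%:C != l0%:C by apply: fE; rewrite eq_sym.
apply: iff_trans; last first.
  exact: iff_sym (lin_equiv_cayley two ab al bl (f0 _ ha) (f0 _ hb) (f0 _ hl) hn hQ0 hQl0).
split=> [per|cay p pt pc k].
  (* The Pell equation involves only [a], [b], [l0] and [n], so periodicity of one nondegenerate
     trajectory yields it. *)
  have [p0 [p1 [e0 e1 ne tan [mus [x0 y0]]]]] := symmetric_chord hb hab hl hla hlb.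
  have [p [p0E p1E pt pc]] := trajectory_exists hb hab hla hlb e0 e1 ne tan.
  have pn := per p pt pc.
  suff : pell a%:C b%:C l0%:C n by apply: pell_cayley => //; exact: f0.
  have [_] := trajectory_pell hb hab hl hla hlb f pt pc hn; apply.
  - by rewrite -{1}[n]add0n pn.
  - by rewrite -{1}[n]add0n -addSn pn.
  - by rewrite p1E.
  - by rewrite p0E.
  by rewrite p0E.
have pl : pell a%:C b%:C l0%:C n by apply: cayley_pell => //; exact: f0.
(* Periodicity at index [k] is the return of the shifted trajectory to its initial vertex. *)
have pt' : billiard_trajectory a b (fun j => p (j + k)%N).
  by case: pt => t1 t2 t3; split=> j.
have pc' : has_caustic a b l0 (fun j => p (j + k)%N) by move=> j; apply: pc.
have [h _] := trajectory_pell hb hab hl hla hlb f pt' pc' hn.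
by rewrite addnC h.
Qed.
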